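(* Let $d\in\mathbb{N}$ and $p(z)=\sum_{k=0}^dc_kz^k$, $c_k\in\mathbb{C}$, $c_d\ne0$, $c_0\ne0$. Let $\{g_n(t)\}_{n=0}^\infty$ be a system of OPRL or OPUC having a generating function of the form $$G(t,w)=f(w)e^{tu(w)}=\sum_{n=0}^\infty g_n(t)\frac{w^n}{n!},\qquad t\in\mathbb{C},\ |w|<R_0,\quad(R_0>0),$$ where $f,u$ are analytic functions in $\{|w|<R_0\}$ and $u(0)=0$. Let $$F(t,w)=\frac{1}{p(u(w))}G(t,w)=\frac{1}{p(u(w))}f(w)e^{tu(w)},$$ and fix some positive $T_1$, $R_1$ (with $R_1<R_0$) such that $F(t,w)$ is analytic in the polydisk $C_{T_1,R_1}=\{(t,w)\in\mathbb{C}^2:|t|<T_1,\ |w|<R_1\}$. The polynomials $$\varphi_n(t)=\sum_{j=0}^n\binom nj b_j\,g_{n-j}(t),\qquad n\in\mathbb{Z}_+,$$ where $b_j=\left(\frac{1}{p(u(w))}\right)^{(j)}(0)$, have the following properties: (i) The polynomials $\varphi_n$ are Sobolev orthogonal polynomials: $$\int\left(\varphi_n(t),\varphi_n'(t),\dots,\varphi_n^{(d)}(t)\right)\widetilde M\,\overline{\begin{pmatrix}\varphi_m(t)\\ \varphi_m'(t)\\ \vdots\\ \varphi_m^{(d)}(t)\end{pmatrix}}\,d\mu_g=\tau_n\delta_{n,m},\qquad \tau_n>0,\quad n,m\in\mathbb{Z}_+,$$ where $\widetilde M=(c_0,c_1,\dots,c_d)^T(\overline{c_0},\overline{c_1},\dots,\overline{c_d})$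 and $\mu_g$ is the measure of orthogonality of $g_n$. (ii) The polynomials $\varphi_n$ have the generating function $F(t,w)$: $$F(t,w)=\sum_{n=0}^\infty\varphi_n(t)\frac{w^n}{n!},\qquad(t,w)\in C_{T_1,R_1}.$$ (iii) The polynomials $\varphi_n$ have the integral representation $$\varphi_n(t)=\frac{n!}{2\pi i}\oint_{|w|=R_2}\frac{1}{p(u(w))}f(w)e^{tu(w)}w^{-n-1}\,dw,\qquad n\in\mathbb{Z}_+,$$ where $R_2$ is an arbitrary number satisfying $0<R_2<R_1$.
   Context: $\mathbb{N}$: positive integers; $\mathbb{Z}_+$: non-negative integers. OPRL (OPUC) are orthogonal polynomials on the real line (respectively on the unit circle): a system $\{g_n\}_{n=0}^\infty$ of complex polynomials, $\deg g_n=n$, for which there is a (non-negative) measure $\mu_g$ on $\mathbb{R}$ (respectively on $\{|z|=1\}$), the measure of orthogonality, with $\int g_n\overline{g_m}\,d\mu_g=A_n\delta_{n,m}$, $A_n>0$, $n,m\in\mathbb{Z}_+$. The integral in (i) is over the real line or the unit circle, respectively. The superscript $(j)$ in $b_j$ denotes the $j$-th derivative with respect to $w$. An overline denotes (entrywise) complex conjugation and $T$ the transpose. *)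

(* Defs.v *)
From HB Require Import structures.
From mathcomp Require Import all_boot all_order all_algebra.
From mathcomp Require Import all_classical all_reals all_analysis.
From mathcomp Require Import complex.

Set Implicit Arguments.
Unset Strict Implicit.
Unset Printing Implicit Defensive.

Import Order.TTheory GRing.Theory Num.Theory numFieldNormedType.Exports.

Local Open Scope classical_set_scope.
Local Open Scope complex_scope.
Local Open Scope ring_scope.

(* Over [R : realType], the complex numbers are [R[i]].  The norm [`|z|] and
   the order are those of [R[i]], so a real bound [r : R] appears in them as
   [r%:C]; topology, limits and derivatives are the ones attached by the
   library to the numFieldType [R[i]]. *)

(* The library registers these structures on abstract numClosedFieldTypes only,
   so they have to be repeated for the concrete type [R[i]]. *)
HB.instance Definition _ (R : realType) := GRing.ComAlgebra.copy R[i] R[i]^o.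
HB.instance Definition _ (R : realType) := Vector.copy R[i] R[i]^o.
HB.instance Definition _ (R : realType) := NormedModule.copy R[i] R[i]^o.

Section ComplexAnalysis.
Context {R : realType}.
Local Notation C := R[i].

(* As for the library's [expR], the exponential is the sum of its series. *)
Definition cexp (z : C) : C := limn (series (fun n => z ^+ n / (n`!)%:R)).

Definition analytic_at (h : C -> C) (z0 : C) : Prop :=
  exists a : nat -> C, exists2 r : R, 0 < r &
    forall z : C, `|z - z0| < r%:C ->
      series (fun n => a n * (z - z0) ^+ n) @ \oo --> h z.

Definition analytic_on (D : set C) (h : C -> C) : Prop :=
  forall z, D z -> analytic_at h z.

(* Absolute convergence makes the sum of a double series independent of the
   order of summation, hence computable along square partial sums. *)
Definition double_series_to (a : nat -> nat -> C) (s : C) : Prop :=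
  (exists B : R, forall N : nat,
      \sum_(j < N) \sum_(k < N) `|a j k| <= B%:C)
  /\ (fun N : nat => \sum_(j < N) \sum_(k < N) a j k) @ \oo --> s.

Definition analytic2_at (H : C -> C -> C) (t0 w0 : C) : Prop :=
  exists a : nat -> nat -> C, exists2 r : R, 0 < r &
    forall t w : C, `|t - t0| < r%:C -> `|w - w0| < r%:C ->
      double_series_to
        (fun j k => a j k * (t - t0) ^+ j * (w - w0) ^+ k) (H t w).

Definition analytic2_on (D : set (C * C)) (H : C -> C -> C) : Prop :=
  forall t w, D (t, w) -> analytic2_at H t w.

Definition disk (r : R) : set C := [set w | `|w| < r%:C].

Definition polydisk (T r : R) : set (C * C) := disk T `*` disk r.

Definition cintegrable d (X : measurableType d)
    (mu : {measure set X -> \bar R}) (D : set X) (h : X -> C) : Prop :=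
  mu.-integrable D (fun x => (complex.Re (h x))%:E) /\
  mu.-integrable D (fun x => (complex.Im (h x))%:E).

Definition cintegral d (X : measurableType d)
    (mu : {measure set X -> \bar R}) (D : set X) (h : X -> C) : C :=
  (\int[mu]_(x in D) complex.Re (h x)) +i* (\int[mu]_(x in D) complex.Im (h x)).

Definition circle_point (r theta : R) : C :=
  (r * cos theta) +i* (r * sin theta).

(* The integral of [h] over the positively oriented circle [|w| = r], through
   w = r e^(i theta), dw = i w d theta, 0 <= theta <= 2 pi. *)
Definition circle_integral (r : R) (h : C -> C) : C :=
  cintegral (@lebesgue_measure R) `[0, 2 * pi]
    (fun theta => h (circle_point r theta) * ('i%C * circle_point r theta)).

Definition real_line : set C := [set z | complex.Im z = 0].

Definition unit_circle : set C := [set z | `|z| = 1].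

Definition borelC := g_sigma_algebraType (@open C).

(* [g] is orthogonal on [S] with respect to [mu].  Integration being over [S],
   only the trace of [mu] on [S] matters: for [S = real_line] or
   [S = unit_circle], [mu] stands for an arbitrary Borel measure on the line or
   on the circle.  Integrability is part of the claim, as the library's
   integral is total. *)
Definition orthogonal_polys (S : set C) (mu : {measure set borelC -> \bar R})
    (g : nat -> {poly C}) : Prop :=
  (forall n, size (g n) = n.+1) /\
  exists A : nat -> R, (forall n, 0 < A n) /\
    forall n m : nat,
      let h (t : borelC) := (g n).[t] * ((g m).[t])^* in
      cintegrable mu S h /\
      cintegral mu S h = if n == m then (A n)%:C else 0.

Definition OPRL mu g : Prop := orthogonal_polys real_line mu g.

Definition OPUC mu g : Prop := orthogonal_polys unit_circle mu g.

Definition genG (f u : C -> C) (t w : C) : C := f w * cexp (t * u w).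

Definition genF (p : {poly C}) (f u : C -> C) (t w : C) : C :=
  (p.[u w])^-1 * genG f u t w.

(* b_j, a complex derivative of order j at 0. *)
Definition recip_coef (p : {poly C}) (u : C -> C) (j : nat) : C :=
  derive1n j (fun w : C => (p.[u w])^-1) 0.

Definition phi (p : {poly C}) (u : C -> C) (g : nat -> {poly C}) (n : nat) :
    {poly C} :=
  \sum_(j < n.+1) ('C(n, j)%:R * recip_coef p u j) *: g (n - j)%N.

Definition jet (d : nat) (q : {poly C}) (t : C) : 'rV[C]_d.+1 :=
  \row_(k < d.+1) (q^`(k)).[t].

Definition sobolev_matrix (d : nat) (c : nat -> C) : 'M[C]_d.+1 :=
  (\row_(k < d.+1) c k)^T *m (\row_(k < d.+1) (c k)^*).

Definition sobolev_integrand (d : nat) (M : 'M[C]_d.+1) (q1 q2 : {poly C})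
    (t : C) : C :=
  (jet d q1 t *m M *m map_mx conjc (jet d q2 t)^T) 0 0.

Definition sobolev_orthogonal (d : nat) (S : set C)
    (mu : {measure set borelC -> \bar R}) (M : 'M[C]_d.+1)
    (q : nat -> {poly C}) : Prop :=
  exists tau : nat -> R, (forall n, 0 < tau n) /\
    forall n m : nat,
      let h (t : borelC) := sobolev_integrand M (q n) (q m) t in
      cintegrable mu S h /\
      cintegral mu S h = if n == m then (tau n)%:C else 0.

End ComplexAnalysis.

Arguments borelC R : clear implicits.
Arguments real_line R : clear implicits.
Arguments unit_circle R : clear implicits.

(* Main.v *)
Require Import Defs.
From HB Require Import structures.
From mathcomp Require Import all_boot all_order all_algebra.
From mathcomp Require Import all_classical all_reals all_analysis.
From mathcomp Require Import complex.
From mathcomp Require Import ring lra.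

(** Write H_t(w) = F(t,w) = e^(t u(w)) f(w) / p(u(w)).

Integral representation and generating function.  Both follow once H_t is
known to be the sum, on the whole disk |w| < R1, of a power series with
Cauchy's integrals as coefficients.  Analyticity being a local notion (a
power series at each point), this is Cauchy's theory, developed here for C1
functions, i.e. functions with a continuous complex derivative.  For |w| < r,
the integral over |z| = r of h(w + l (z - w)) dz / (z - w) has derivative in
l equal to the integral of h'(w + l (z - w)) dz, which vanishes because its
integrand has a primitive along the circle; hence it takes the same value at
l = 1 and l = 0 ([cint_homotopy]), which is Cauchy's formula.  Expanding
z / (z - w) as a geometric series ([cint_geometric]) turns the formula into
the Taylor expansion ([C1_taylor], [C1_pseries]).  The function H_0 is
analytic on the disk as a slice of F, and H_t = H_0 e^(t u) is then C1 for
every complex t ([genF_C1]).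

Identification of the coefficients.  It only remains to see that the n-th
Taylor coefficient of H_t at 0 is phi_n(t) / n!.  As p(u(0)) = c_0 is not 0,
p(u(w)) does not vanish near 0, where H_t = (1 / p(u)) G(t,.) is thus a
product of two functions with known expansions, and phi_n is exactly their
Cauchy product.  Expansions are multiplied as polynomials modulo O(w^(n+1))
([taylor], [taylorM], [taylor_uniq]), which avoids products of series.

Sobolev orthogonality.  The matrix c c^* has rank one, so the Sobolev
integrand of phi_n and phi_m is (p(D) phi_n) times the conjugate of
(p(D) phi_m), with D the derivation in t ([sobolev_integrand_rank_one]).
As D multiplies e^(t u(w)) by u(w), the operator p(D) multiplies F by p(u)
and so maps F to G; hence p(D) phi_n = g_n ([phi_taylor]), and the
Sobolev orthogonality of phi is the orthogonality of g, with the same norms.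
On coefficients, the rule for D is an identity between polynomials, because
u(0) = 0 lets only finitely many powers of u contribute to the coefficient
of w^n ([derivn_exp_coefs]). *)

Set Implicit Arguments.
Unset Strict Implicit.
Unset Printing Implicit Defensive.

Import Order.TTheory GRing.Theory Num.Theory numFieldNormedType.Exports.

Local Open Scope classical_set_scope.
Local Open Scope complex_scope.
Local Open Scope ring_scope.

(** * Topology and derivatives in the complex plane *)

Section ComplexTopology.
Context {R : realType}.
Local Notation C := R[i].

Lemma Re_continuous : continuous (@complex.Re R : C -> R).
Proof.
move=> z.
apply/(@cvgrPdist_lt _ _ _ _ (nbhs_filter z)) => e e0.
have e0' : 0 < e%:C by rewrite ltcR.
near=> w.
have : `|z - w| < e%:C.
  by near: w; apply/nbhs_ballP; exists e%:C.
by rewrite -raddfB/= -ltcR; apply: le_lt_trans; exact: normc_ge_Re.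
Unshelve. all: by end_near. Qed.

Lemma real_complex_continuous : continuous (fun x : R => x%:C : C).
Proof.
move=> x.
apply/cvgrPdist_lt => e.
rewrite ltcE => /andP [/eqP/= Ie e0].
near=> y.
rewrite -rmorphB/= normc_def /= expr0n/= addr0 sqrtr_sqr ltcE/= -Ie eqxx/=.
near: y.
by apply/nbhs_ballP; exists (complex.Re e).
Unshelve. all: by end_near. Qed.

Lemma cvgC_ReIm T (F : set_system T) (FF : Filter F) (u : T -> C) l :
  (fun x => complex.Re (u x)) @ F --> complex.Re l ->
  (fun x => complex.Im (u x)) @ F --> complex.Im l -> u @ F --> l.
Proof.
move=> h k.
have -> : u = fun x => (complex.Re (u x))%:C + 'i%C * (complex.Im (u x))%:C.
  by apply/funext => x; exact: complexE.
rewrite [l]complexE.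
have ch := cvg_comp _ _ h (@real_complex_continuous _).
have ck := cvg_comp _ _ k (@real_complex_continuous _).
exact: (cvgD ch (cvgM (cvg_cst _) ck)).
Qed.

Lemma real_norm (z : C) : (complex.Re `|z|)%:C = `|z|.
Proof. by rewrite RRe_real// normr_real. Qed.

(** Completeness of the plane, in the only form used here: it is inherited from
the real line through the real and imaginary parts. *)
Lemma cvg_norm_summable (a : nat -> C) (B : C) :
  (forall N, \sum_(k < N) `|a k| <= B) -> exists l : C, series a @ \oo --> l.
Proof.
move=> aB.
have part (r : C -> R) : {morph r : x y / x + y} -> r 0 = 0 ->
    (forall z, `|r z|%:C <= `|z|) ->
    cvgn (series (r \o a)).
  move=> rD r0 rn; apply: normed_cvg.
  apply: nondecreasing_is_cvgn.
    by apply: nondecreasing_series => n _ _; exact: normr_ge0.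
  exists (complex.Re B) => _ [N _ <-].
  rewrite -lecR /normed_series_of /series/= big_mkord rmorph_sum/=.
  apply: (@le_trans _ _ (\sum_(k < N) `|a k|)); first exact: ler_sum.
  rewrite RRe_real// realE (le_trans _ (aB N))//.
  exact: sumr_ge0.
have /cvg_ex[l1 h1] : cvgn (series (fun n => complex.Re (a n))).
  by apply: (part (@complex.Re R)) => //; [exact: raddfD|exact: normc_ge_Re].
have /cvg_ex[l2 h2] : cvgn (series (fun n => complex.Im (a n))).
  apply: (part (@complex.Im R)) => //; first exact: raddfD.
  by move=> z; rewrite normc_def lecR -sqrtr_sqr ler_wsqrtr// lerDr sqr_ge0.
exists (l1 +i* l2); apply: cvgC_ReIm => /=.
  rewrite (_ : (fun _ => _) = series (fun n => complex.Re (a n)))//.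
  by apply/funext => n; rewrite /series/= raddf_sum.
rewrite (_ : (fun _ => _) = series (fun n => complex.Im (a n)))//.
by apply/funext => n; rewrite /series/= raddf_sum.
Qed.

End ComplexTopology.

Section ComplexDerivative.
Context {R : realType}.
Local Notation C := R[i].

(** Caratheodory's form of the derivative: the difference quotient extends to a
function with limit [l].  The increment of the variable is that of [j], so
that one notion covers both functions of a complex variable ([j] the
identity) and curves ([j] the inclusion of the real line); the rules of
calculus then become algebraic identities. *)
Definition slope_along T (F : set_system T) (j h : T -> C) (z : T) (l : C) :=
  exists2 q : T -> C, q x @[x --> F] --> l &
    forall w, h w = h z + q w * (j w - j z).

Section Filtered.
Variables (T : Type) (F : set_system T) (j : T -> C) (z : T).
Context {FF : Filter F}.
Hypothesis cj : j x @[x --> F] --> j z.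
Implicit Types h k : T -> C.

Lemma slope_along_continuous h l :
  slope_along F j h z l -> h x @[x --> F] --> h z.
Proof.
move=> [q cq hq].
rewrite (_ : h = fun w => h z + q w * (j w - j z)); last exact/funext.
rewrite [X in _ --> X](_ : _ = h z + l * (j z - j z)); last first.
  by rewrite !subrr !mulr0.
exact: (cvgD (cvg_cst _) (cvgM cq (cvgB cj (cvg_cst _)))).
Qed.

Lemma slope_along_cst (c : C) : slope_along F j (fun=> c) z 0.
Proof.
exists (fun=> 0); first exact: cvg_cst.
by move=> w; rewrite mul0r addr0.
Qed.

Lemma slope_along_id : slope_along F j j z 1.
Proof.
exists (fun=> 1); first exact: cvg_cst.
by move=> w; rewrite mul1r addrC subrK.
Qed.

Lemma slope_alongD h k l m :
  slope_along F j h z l -> slope_along F j k z m ->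
  slope_along F j (fun w => h w + k w) z (l + m).
Proof.
move=> [q cq hq] [p cp kp].
exists (fun w => q w + p w); first exact: (cvgD cq cp).
by move=> w; rewrite {1}hq {1}kp mulrDl addrACA.
Qed.

Lemma slope_alongM h k l m :
  slope_along F j h z l -> slope_along F j k z m ->
  slope_along F j (fun w => h w * k w) z (l * k z + h z * m).
Proof.
move=> sh sk; have ck := slope_along_continuous sk.
move: sh sk => [q cq hq] [p cp kp].
exists (fun w => q w * k w + h z * p w).
  exact: (cvgD (cvgM cq ck) (cvgM (cvg_cst _) cp)).
move=> w.
have hk : h w - h z = q w * (j w - j z) by rewrite hq addrAC subrr add0r.
have kk : k w - k z = p w * (j w - j z) by rewrite kp addrAC subrr add0r.
by rewrite mulrDl mulrAC -hk -[h z * p w * _]mulrA -kk; ring.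
Qed.

(** The quotient of the composite is the product of the two quotients; no case
distinction on a vanishing increment arises. *)
Lemma slope_along_comp h (k : C -> C) l m :
  slope_along F j h z l -> slope_along (nbhs (h z)) id k (h z) m ->
  slope_along F j (fun w => k (h w)) z (m * l).
Proof.
move=> sh; have ch := slope_along_continuous sh.
move: sh => [q cq hq] [p cp kp].
exists (fun w => p (h w) * q w); first exact: cvgM (cvg_comp _ _ ch cp) cq.
by move=> w; rewrite {1}kp [X in _ * (X - _)]hq [h z + _ - _]addrC addKr mulrA.
Qed.

End Filtered.

Definition cder (h : C -> C) (z l : C) := slope_along (nbhs z) id h z l.

Lemma cderV (z : C) : z != 0 -> cder (fun w : C => w^-1) z (- z ^- 2).
Proof.
move=> z0; exists (fun w => if w == 0 then z ^- 2 else - (w^-1 * z^-1)).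
  have : - (x^-1 * z^-1) @[x --> z] --> - z ^- 2.
    rewrite expr2 invfM.
    have h1 : x^-1 @[x --> z] --> z^-1 by exact: inv_continuous.
    have h2 : x^-1 * z^-1 @[x --> z] --> z^-1 * z^-1.
      exact: (cvgM h1 (cvg_cst _)).
    exact: (cvgN h2).
  apply: cvg_trans; apply: near_eq_cvg.
  near=> w; rewrite ifF//; apply/negbTE.
  near: w; apply/nbhs_ballP; exists `|z|; first by rewrite /= normr_gt0.
  move=> w; rewrite /ball/=; apply: contraTneq => ->.
  by rewrite subr0 ltxx.
move=> w; case: (eqVneq w 0) => [->|w0].
  by rewrite invr0 sub0r mulrN expr2 invfM -mulrA mulVf// mulr1 subrr.
rewrite mulrBr !mulNr opprK mulrAC mulVf// mul1r -mulrA mulVf// mulr1.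
by rewrite addrA subrr add0r.
Unshelve. all: by end_near. Qed.

Lemma cder_derive1 (h : C -> C) z l : cder h z l -> derive1 h z = l.
Proof.
move=> [q cq hq]; rewrite /derive1; apply: cvg_lim; first exact: norm_hausdorff.
have : q (x + z) @[x --> 0^'] --> l.
  have : q (x + z) @[x --> (0:C)] --> l.
    apply: (cvg_comp (fun x => x + z) q _ cq).
    have h1 : (x + z : C) @[x --> (0 : C)] --> 0 + z.
      have h2 : (x : C) @[x --> (0 : C)] --> (0 : C) by exact: cvg_id.
      exact: (cvgD h2 (cvg_cst _)).
    by rewrite add0r in h1.
  by apply: cvg_trans; apply: cvg_app; exact: cvg_within.
apply: cvg_trans; apply: near_eq_cvg; near=> x.
rewrite (hq (x + z)) [h z + _]addrC addrK addrK mulrC -[_ *: _]/(_ * _) mulKf//.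
near: x; exact: nbhs_dnbhs_neq.
Unshelve. all: by end_near. Qed.

(** The criterion by which power series are differentiated. *)
Lemma cder_second_order (h : C -> C) z l (r M : C) : 0 < r -> 0 <= M ->
  (forall w, `|w - z| < r -> `|h w - h z - l * (w - z)| <= M * `|w - z| ^+ 2) ->
  cder h z l.
Proof.
move=> r0 M0 hM.
exists (fun w => if w == z then l else (h w - h z) / (w - z)).
  have Mp : 0 < M + 1 by rewrite ltr_wpDl.
  apply/cvgrPdist_lt => e e0.
  near=> w; case: ifPn => [_|wz]; first by rewrite subrr normr0.
  have wz0 : w - z != 0 by rewrite subr_eq0.
  have wr : `|w - z| < r.
    near: w; apply/nbhs_ballP; exists r => // w; rewrite /ball/= distrC//.
  have : `|l - (h w - h z) / (w - z)| <= M * `|w - z|.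
    rewrite distrC -(ler_pM2r (_ : 0 < `|w - z|)) ?normr_gt0//.
    by rewrite -normrM mulrBl divfK// (le_trans (hM _ wr))// -mulrA expr2.
  move/le_lt_trans; apply.
  apply: (@le_lt_trans _ _ ((M + 1) * `|w - z|)); first by rewrite ler_wpM2r// lerDl.
  rewrite mulrC -ltr_pdivlMr//.
  near: w; apply/nbhs_ballP; exists (e / (M + 1)) => /=; first exact: divr_gt0.
  by move=> w; rewrite /ball/= distrC.
move=> w; case: eqVneq => [->|wz]; first by rewrite subrr mulr0 addr0.
by rewrite divfK ?subr_eq0// addrC subrK.
Unshelve. all: by end_near. Qed.
End ComplexDerivative.

(** * Power series *)

(** Termwise form of the second order remainder of a partial sum; the indices
are shifted since the terms of degree 0 and 1 have no remainder. *)
Lemma pseries_second_order_sum (A : comNzRingType) (a : nat -> A) (x y : A) N :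
  \sum_(k < N.+2) a k * y ^+ k - \sum_(k < N.+2) a k * x ^+ k
    - (\sum_(k < N.+1) k.+1%:R * a k.+1 * x ^+ k) * (y - x)
  = \sum_(k < N) a k.+2 *
      (y ^+ k.+2 - x ^+ k.+2 - k.+2%:R * x ^+ k.+1 * (y - x)).
Proof.
rewrite 2!big_ord_recl [X in _ - X - _]big_ord_recl.
rewrite [X in _ - (_ + X) - _]big_ord_recl [X in _ - X * _]big_ord_recl.
rewrite /bump/= !expr0 !expr1.
transitivity (\sum_(k < N) a k.+2 * y ^+ k.+2 - \sum_(k < N) a k.+2 * x ^+ k.+2
   - (\sum_(k < N) k.+2%:R * a k.+2 * x ^+ k.+1) * (y - x)); first ring.
rewrite mulr_suml -!sumrB; apply: eq_bigr => k _; ring.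
Qed.

Section PowerSeries.
Context {R : realType}.
Local Notation C := R[i].
Implicit Types (a : nat -> C) (h : C -> C).

(** Norms are compared in the partially ordered field of complex numbers, hence
this direct argument. *)
Lemma cvg_norm_le (u : nat -> C) (l B : C) :
  u @ \oo --> l -> (forall n, `|u n| <= B) -> `|l| <= B.
Proof.
move=> ul uB.
have B0 : 0 <= B by apply: le_trans (uB 0%N).
rewrite real_leNgt ?realE ?normr_ge0 ?B0//; apply/negP => Bl.
move/cvgrPdist_lt : ul => /(_ (`|l| - B)); rewrite subr_gt0 => /(_ Bl).
case=> N _ /(_ N (leqnn _)) /= luN.
have : `|l| < `|l|.
  rewrite -{1}[l](subrK (u N)); apply: (le_lt_trans (ler_normD _ _)).
  by rewrite -[ltRHS](subrK B) ltr_leD.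
by rewrite ltxx.
Qed.

Lemma geometric_sum_le (q : C) N : 0 <= q -> q < 1 ->
  \sum_(k < N) q ^+ k <= (1 - q)^-1.
Proof.
move=> q0 q1; have d0 : 0 < 1 - q by rewrite subr_gt0.
rewrite -(ler_pM2l d0) divff ?gt_eqF// -opprB mulNr -subrX1 opprB.
by rewrite lerBlDr lerDl exprn_ge0.
Qed.

(** The bound of Abel's lemma: it holds at every radius smaller than that of
convergence, and conversely gives absolute convergence at smaller radii. *)
Definition geo_bounded a (rho : C) := exists2 M, 0 <= M & forall n, `|a n| * rho ^+ n <= M.

Lemma cvg_geo_bounded a (z l : C) :
  series (fun n => a n * z ^+ n) @ \oo --> l -> geo_bounded a `|z|.
Proof.
move=> al.
have /cvgP/cvg_seq_bounded : (fun n => a n * z ^+ n) @ \oo --> (0 : C).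
  by apply: cvg_series_cvg_0; apply/cvg_ex; exists l.
move=> [M [Mreal hM]]; exists (`|M| + 1); first by rewrite addr_ge0.
move=> n; rewrite -normrX -normrM; apply: hM => //.
by rewrite (le_lt_trans (real_ler_norm Mreal))// ltrDl.
Qed.

Lemma geo_bounded_sum a (rho s : C) : 0 <= s -> s < rho -> geo_bounded a rho ->
  exists2 K, 0 <= K & forall N, \sum_(k < N) `|a k| * s ^+ k <= K.
Proof.
move=> s0 sr [M M0 aM].
have r0 : 0 < rho by exact: le_lt_trans sr.
have q0 : 0 <= s / rho by rewrite divr_ge0// ltW.
have q1 : s / rho < 1 by rewrite ltr_pdivrMr// mul1r.
exists (M * (1 - s / rho)^-1).
  by rewrite mulr_ge0// invr_ge0 subr_ge0 ltW.
move=> N; apply: le_trans (ler_wpM2l M0 (geometric_sum_le N q0 q1)).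
rewrite mulr_sumr; apply: ler_sum => k _.
rewrite -[s in leLHS](divfK (lt0r_neq0 r0)) exprMn mulrCA mulrC.
by rewrite ler_wpM2r// exprn_ge0.
Qed.

Lemma geo_bounded_cvg a (rho z : C) : `|z| < rho -> geo_bounded a rho ->
  exists l : C, series (fun n => a n * z ^+ n) @ \oo --> l.
Proof.
move=> zr /(geo_bounded_sum (normr_ge0 z) zr)[K _ hK].
apply: (@cvg_norm_summable _ _ K) => N; apply: le_trans (hK N).
by apply: ler_sum => k _; rewrite normrM normrX.
Qed.

Definition dcoef a : nat -> C := fun k => k.+1%:R * a k.+1.

(** A factor k is absorbed by a slightly smaller radius, because
k q^k <= 1 + q + ... + q^(k-1) <= 1 / (1 - q). *)
Lemma geo_bounded_dcoef a (rho s : C) : 0 < s -> s < rho -> geo_bounded a rho ->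
  geo_bounded (dcoef a) s.
Proof.
move=> s0 sr [M M0 aM].
have r0 : 0 < rho by exact: lt_trans sr.
have q0 : 0 <= s / rho by rewrite divr_ge0// ltW.
have q1 : s / rho < 1 by rewrite ltr_pdivrMr// mul1r.
exists (M / s * (1 - s / rho)^-1).
  by rewrite !(mulr_ge0, divr_ge0)// ?invr_ge0 ?subr_ge0 ltW.
move=> n; apply: le_trans (ler_wpM2l _ (geometric_sum_le n.+1 q0 q1)); last first.
  by rewrite divr_ge0// ltW.
apply: (@le_trans _ _ (M / s * (n.+1%:R * (s / rho) ^+ n.+1))); last first.
  rewrite ler_wpM2l ?divr_ge0 ?(ltW s0)//.
  rewrite mulr_natl -[X in _ *+ X]card_ord -sumr_const ler_sum// => i _.
  by apply: ler_wiXn2l => //; [exact: ltW|exact: ltnW].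
rewrite /dcoef normrM normr_nat.
rewrite [leLHS](_ : _ = n.+1%:R * ((`|a n.+1| * rho ^+ n.+1) * ((s / rho) ^+ n.+1 / s))); last first.
  by rewrite expr_div_n !exprS; field; rewrite !gt_eqF// exprn_gt0.
rewrite [leRHS](_ : _ = n.+1%:R * (M * ((s / rho) ^+ n.+1 / s))); last by ring.
by rewrite ler_wpM2l// ler_wpM2r// divr_ge0 ?exprn_ge0// ltW.
Qed.

(** The remainder E_n of index n satisfies
E_(n+1) = y E_n + n x^(n-1) (y - x)^2, whence the bound by induction. *)
Lemma pow_second_order (x y rho : C) n : `|x| <= rho -> `|y| <= rho ->
  `|y ^+ n.+2 - x ^+ n.+2 - n.+2%:R * x ^+ n.+1 * (y - x)|
    <= n.+1%:R * n.+2%:R * rho ^+ n * `|y - x| ^+ 2.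
Proof.
move=> xr yr; have r0 : 0 <= rho by exact: le_trans xr.
elim: n => [|n IH].
  rewrite (_ : y ^+ 2 - _ - _ = (y - x) ^+ 2); last by ring.
  by rewrite normrX expr0 mulr1 mul1r ler_peMl ?exprn_ge0// ler1n.
rewrite (_ : y ^+ n.+3 - _ - _ =
  y * (y ^+ n.+2 - x ^+ n.+2 - n.+2%:R * x ^+ n.+1 * (y - x))
  + n.+2%:R * x ^+ n.+1 * (y - x) ^+ 2); last first.
  rewrite !exprS (_ : n.+3%:R = n.+2%:R + 1); last by rewrite -natr1.
  by ring.
rewrite (le_trans (ler_normD _ _))//.
rewrite [leRHS](_ : _ = rho * (n.+1%:R * n.+2%:R * rho ^+ n * `|y - x| ^+ 2)
  + (n.+2%:R + n.+2%:R) * rho ^+ n.+1 * `|y - x| ^+ 2); last first.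
  rewrite exprS (_ : n.+3%:R = n.+1%:R + 1 + 1); last by rewrite !natr1.
  by rewrite -natr1; ring.
apply: lerD; first by rewrite normrM ler_pM.
rewrite !normrM !normrX normr_nat; apply: ler_wpM2r; first by rewrite mulr_ge0.
apply: ler_pM; rewrite ?exprn_ge0//.
  by rewrite lerDl.
by rewrite lerXn2r// nnegrE.
Qed.

Definition has_pseries a (z0 r : C) h := forall z, `|z - z0| < r ->
  series (fun n => a n * (z - z0) ^+ n) @ \oo --> h z.

Lemma has_pseries_geo_bounded a z0 r h rho : has_pseries a z0 r h ->
  0 <= rho -> rho < r -> geo_bounded a rho.
Proof.
move=> ah rho0 rhor.
have := ah (z0 + rho); rewrite addrAC subrr add0r ger0_norm// => /(_ rhor).
by move/cvg_geo_bounded; rewrite ger0_norm.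
Qed.

Lemma has_pseries_center a z0 r h : 0 < r -> has_pseries a z0 r h -> h z0 = a 0%N.
Proof.
move=> r0 /(_ z0); rewrite subrr normr0 => /(_ r0) ah.
have h0 : series (fun n => a n * (0 : C) ^+ n) @ \oo --> a 0%N.
  rewrite -(cvg_shiftn 1)/=; apply: cvg_near_cst; apply: nearW => n.
  rewrite /series/= big_mkord addn1 big_ord_recl expr0 mulr1 big1 ?addr0// => i _.
  by rewrite expr0n mulr0.
exact: (cvg_unique _ ah h0).
Qed.

Lemma midpoint (x y : C) : x < y -> exists2 m, x < m & m < y.
Proof. by move=> xy; exists ((x + y) / 2); rewrite ?midf_lt. Qed.

(** The second order remainders add up to at most K |w - z|^2, where K bounds the
sums of the second derived series, obtained by shrinking the radius twice. *)
Lemma has_pseries_cder a z0 r h : has_pseries a z0 r h ->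
  forall z, `|z - z0| < r -> exists2 l : C,
    series (fun n => dcoef a n * (z - z0) ^+ n) @ \oo --> l & cder h z l.
Proof.
move=> ah z zr.
(* Four nested radii: one for the bound on the coefficients, one for each of
   the two derivations, and one for the points w. *)
have [r4 z4 r4r] := midpoint zr; have [r3 z3 r34] := midpoint z4.
have [r2 z2 r23] := midpoint z3; have [r1 z1 r12] := midpoint z2.
have zp s : `|z - z0| < s -> 0 < s by exact: le_lt_trans.
have b4 := has_pseries_geo_bounded ah (ltW (zp _ z4)) r4r.
have b3 := geo_bounded_dcoef (zp _ z3) r34 b4.
have b2 := geo_bounded_dcoef (zp _ z2) r23 b3.
have [l al] := geo_bounded_cvg z3 b3.
exists l => //.
have [K K0 hK] := geo_bounded_sum (ltW (zp _ z1)) r12 b2.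
apply: (@cder_second_order _ _ _ _ (r1 - `|z - z0|) K) => //.
  by rewrite subr_gt0.
move=> w wz.
have w1 : `|w - z0| < r1.
  rewrite -[w](subrK z) -addrA; apply: (le_lt_trans (ler_normD _ _)).
  by rewrite -ltrBrDr.
have wr : `|w - z0| < r by exact: (lt_trans w1 (lt_trans r12 (lt_trans r23 (lt_trans r34 r4r)))).
(* The shifts by 2, 2 and 1 align the partial sums with
   [pseries_second_order_sum]. *)
have := ah _ zr; rewrite -(cvg_shiftn 2) => zc.
have := ah _ wr; rewrite -(cvg_shiftn 2) => wc.
move: al; rewrite -(cvg_shiftn 1) => lc.
apply: (cvg_norm_le (cvgB (cvgB wc zc) (cvgM lc (cvg_cst (w - z))))) => N.
apply: (@le_trans _ _ ((\sum_(k < N) `|dcoef (dcoef a) k| * r1 ^+ k) * `|w - z| ^+ 2)); last first.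
  by rewrite ler_wpM2r// exprn_ge0.
set x := z - z0; set y := w - z0.
have yx : w - z = y - x by rewrite /y /x opprB addrA subrK.
have E : (series (fun n => a n * y ^+ n) (N + 2)%N
  - series (fun n => a n * x ^+ n) (N + 2)%N
  - series (fun n => dcoef a n * x ^+ n) (N + 1)%N * (w - z))
  = \sum_(k < N) a k.+2 *
      (y ^+ k.+2 - x ^+ k.+2 - k.+2%:R * x ^+ k.+1 * (y - x)).
  rewrite yx addn1 addn2 -pseries_second_order_sum.
  by congr (_ - _ - _ * _); exact: (congr1 (fun f => f _) (seriesEord _)).
apply: (@le_trans _ _ `|\sum_(k < N) a k.+2 *
      (y ^+ k.+2 - x ^+ k.+2 - k.+2%:R * x ^+ k.+1 * (y - x))|).
  by rewrite -E; exact: lexx.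
rewrite yx mulr_suml; apply: le_trans (ler_norm_sum _ _ _) _.
apply: ler_sum => k _; rewrite normrM.
apply: le_trans (ler_wpM2l (normr_ge0 _) (pow_second_order _ (ltW z1) (ltW w1))) _.
rewrite /dcoef !normrM !normr_nat.
by rewrite le_eqVlt; apply/orP; left; apply/eqP; ring.
Qed.

Lemma has_pseries_derive1 a z0 r h :
  has_pseries a z0 r h -> has_pseries (dcoef a) z0 r (derive1 h).
Proof.
move=> ah z /(has_pseries_cder ah)[l al hl].
rewrite (cder_derive1 hl); exact: al.
Qed.

Lemma has_pseries_derive1n a z0 r h n :
  has_pseries a z0 r h -> has_pseries (iter n dcoef a) z0 r (derive1n n h).
Proof.
move=> ah; elim: n => [|n IH]; first exact: ah.
exact: (has_pseries_derive1 IH).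
Qed.

Lemma iter_dcoef a n k : (iter n dcoef a) k * k`!%:R = (n + k)`!%:R * a (n + k)%N.
Proof.
elim: n k => [|n IH] k; first by rewrite mulrC.
rewrite iterS /dcoef mulrAC -natrM -factS mulrC IH.
by rewrite addSnnS.
Qed.

Lemma derive1n_pseries a r h n : 0 < r -> has_pseries a 0 r h ->
  derive1n n h 0 = n`!%:R * a n.
Proof.
move=> r0 ah; rewrite (has_pseries_center r0 (has_pseries_derive1n (n := n) ah)).
by have := iter_dcoef a n 0; rewrite fact0 mulr1 addn0.
Qed.

(** The derivative is a parameter rather than [derive1 h] so that the rules of
calculus produce it without computing limits. *)
Definition C1_disk (r : C) h h' := forall z, `|z| < r ->
  cder h z (h' z) /\ h' x @[x --> z] --> h' z.

Lemma cder_continuous h z l : cder h z l -> h x @[x --> z] --> h z.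
Proof. by apply: slope_along_continuous; exact: cvg_id. Qed.

Lemma has_pseries_C1 a z0 r h : has_pseries a z0 r h ->
  forall z, `|z - z0| < r ->
  cder h z (derive1 h z) /\ derive1 h x @[x --> z] --> derive1 h z.
Proof.
move=> ah z zr.
have [l _ hl] := has_pseries_cder ah zr.
have [l' _ hl'] := has_pseries_cder (has_pseries_derive1 ah) zr.
rewrite (cder_derive1 hl); split => //.
by rewrite -(cder_derive1 hl); exact: cder_continuous hl'.
Qed.

Lemma analytic_C1 (r : R) h : analytic_on (disk r) h -> C1_disk r%:C h (derive1 h).
Proof.
move=> ah z zr; have [a [s s0 has]] := ah z zr.
apply: (@has_pseries_C1 a z s%:C); first exact: has.
by rewrite subrr normr0 ltcR.
Qed.

End PowerSeries.

(** * Integrals over a period of the circle *)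

Section CircleIntegrals.
Context {R : realType}.
Local Notation C := R[i].
Local Notation mu := (@lebesgue_measure R).
Implicit Types (k : R -> C).

Definition rder k (x : R) (l : C) :=
  slope_along (nbhs x) (fun y : R => y%:C) k x l.

Lemma cvg_nbhs_eq (q : R -> C) (x : R) (l : C) : q y @[y --> x] --> l -> q x = l.
Proof.
move=> ql; apply/eqP; rewrite eq_sym -subr_eq0; apply: contraT => lq.
move/cvgrPdist_lt : ql => /(_ `|l - q x|); rewrite normr_gt0 => /(_ lq).
by move/nbhs_singleton; rewrite ltxx.
Qed.

Lemma rder_Re k x l : rder k x l ->
  is_derive x (1 : R) (fun y => complex.Re (k y)) (complex.Re l).
Proof.
move=> [q cq hq]; have qx := cvg_nbhs_eq cq.
apply/is_derive1_caratheodory; exists (fun y => complex.Re (q y)); split.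
- move=> y; rewrite hq raddfD/= addrAC subrr add0r.
  rewrite -rmorphB/=; case: (q y) => a b /=.
  by rewrite mulr0 subr0.
- rewrite /prop_for/continuous_at qx.
  exact: cvg_comp _ _ cq (@Re_continuous _ _).
- by rewrite qx.
Qed.

Lemma real_rder (f : R -> R) x l : is_derive x (1 : R) f l ->
  rder (fun y => (f y)%:C) x l%:C.
Proof.
move=> /is_derive1_caratheodory[g [fg cg gx]].
exists (fun y => (g y)%:C).
  rewrite -gx; exact: cvg_comp _ _ cg (@real_complex_continuous _ _).
by move=> y; rewrite -rmorphB -rmorphM -fg rmorphB/= addrC subrK.
Qed.

Lemma rder_continuous k x l : rder k x l -> k y @[y --> x] --> k x.
Proof. by apply: slope_along_continuous; exact: real_complex_continuous. Qed.

Lemma rder_comp k (h : C -> C) x l m : rder k x l -> cder h (k x) m ->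
  rder (fun y => h (k y)) x (m * l).
Proof. by apply: slope_along_comp; exact: real_complex_continuous. Qed.

Lemma rderM k h x l m : rder k x l -> rder h x m ->
  rder (fun y => k y * h y) x (l * h x + k x * m).
Proof. by apply: slope_alongM; exact: real_complex_continuous. Qed.

Lemma rder_cst (c : C) x : rder (fun=> c) x 0.
Proof. exact: slope_along_cst. Qed.

Lemma rderZ (c : C) k x l : rder k x l -> rder (fun y => c * k y) x (c * l).
Proof.
by move=> kl; have := rderM (rder_cst c x) kl; rewrite mul0r add0r.
Qed.

Lemma circle_pointE r t :
  circle_point r t = r%:C * ((cos t)%:C + 'i%C * (sin t)%:C) :> C.
Proof. by rewrite /circle_point; simpc. Qed.

Lemma rder_circle_point r t :
  rder (circle_point r) t ('i%C * circle_point r t).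
Proof.
have c1 := real_rder (is_derive_cos t).
have s1 := rderZ 'i%C (real_rder (is_derive_sin t)).
have E : 'i%C * circle_point r t = r%:C * ((- sin t)%:C + 'i%C * (cos t)%:C).
  rewrite circle_pointE rmorphN/=.
  by rewrite mulrCA mulrDr mulrA -expr2 sqr_i mulN1r addrC.
rewrite E (_ : circle_point r = fun y => r%:C * ((cos y)%:C + 'i%C * (sin y)%:C)).
  exact: (rderZ r%:C (slope_alongD c1 s1)).
by apply/funext => y; rewrite circle_pointE.
Qed.

Lemma circle_point_2pi r : circle_point r (2 * pi) = circle_point r 0 :> C.
Proof.
by rewrite !circle_pointE mulr_natl cos2pi sin2pi cos0 sin0.
Qed.

Lemma norm_circle_point r t : 0 <= r -> `|circle_point r t| = r%:C :> C.
Proof.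
move=> r0; rewrite normc_def /= !exprMn -mulrDr cos2Dsin2 mulr1 sqrtr_sqr.
by rewrite ger0_norm.
Qed.

Definition cint k : C := cintegral mu `[0, 2 * pi] k.

Lemma pi2_gt0 : 0 < 2 * pi :> R. Proof. by rewrite mulr_gt0// pi_gt0. Qed.

Lemma Re_integrable k : continuous k ->
  mu.-integrable `[0, 2 * pi] (EFin \o (fun t => complex.Re (k t))).
Proof.
move=> ck; apply: continuous_compact_integrable; first exact: segment_compact.
apply: continuous_subspaceT => x.
exact: cvg_comp _ _ (ck x) (@Re_continuous _ _).
Qed.

(** Real part of the integral; as Im k = Re (- i k), the imaginary part is
another instance of it, so that results on real integrals need only be
transferred once. *)
Definition rint k : R := \int[mu]_(t in `[0, 2 * pi]) complex.Re (k t).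

Lemma cintE k : cint k = rint k +i* rint (fun t => - 'i%C * k t).
Proof.
congr (_ +i* _); congr (fine _); apply: eq_integral => t _; congr EFin.
by case: (k t) => a b /=; simpc.
Qed.

Lemma rintD k k' : continuous k -> continuous k' ->
  rint (fun t => k t + k' t) = rint k + rint k'.
Proof.
move=> ck ck'; rewrite -RintegralD//; last 2 first.
  exact: Re_integrable.
  exact: Re_integrable.
by apply: eq_Rintegral => t _; rewrite raddfD.
Qed.

Lemma rintZ (c : R) k : continuous k -> rint (fun t => c%:C * k t) = c * rint k.
Proof.
move=> ck; rewrite -RintegralZl//; last exact: Re_integrable.
apply: eq_Rintegral => t _; case: (k t) => a b /=; by rewrite mul0r subr0.
Qed.

Lemma continuous_mulC (c : C) k : continuous k -> continuous (fun t => c * k t).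
Proof. move=> ck t; exact: cvgM (cvg_cst _) (ck t). Qed.

Lemma cintD k k' : continuous k -> continuous k' ->
  cint (fun t => k t + k' t) = cint k + cint k'.
Proof.
move=> ck ck'; rewrite !cintE rintD//.
rewrite -[RHS]/((_ + _) +i* (_ + _)); congr (_ +i* _).
rewrite -rintD; [|exact: continuous_mulC..].
by congr rint; apply/funext => t; rewrite mulrDr.
Qed.

Lemma cintZ (c : C) k : continuous k -> cint (fun t => c * k t) = c * cint k.
Proof.
move=> ck; have cki := continuous_mulC (c := - 'i%C) ck.
have main (a b : R) : rint (fun t => (a +i* b) * k t)
    = a * rint k - b * rint (fun t => - 'i%C * k t).
  rewrite -mulNr -!rintZ// -rintD; [|exact: continuous_mulC..].
  congr rint; apply/funext => t; rewrite mulrA -mulrDl; congr (_ * _).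
  by simpc.
rewrite !cintE; case: c => a b; rewrite main.
have -> : rint (fun t => - 'i%C * ((a +i* b) * k t)) =
    rint (fun t => (b +i* - a) * k t).
  by congr rint; apply/funext => t; rewrite mulrA; congr (_ * _); simpc.
rewrite main.
by apply/eqP; rewrite eq_complex /=; apply/andP; split; apply/eqP; ring.
Qed.

Lemma rint_norm_le k (M : R) : continuous k ->
  (forall t, 0 <= t <= 2 * pi -> `|k t| <= M%:C) -> `|rint k| <= M * (2 * pi).
Proof.
move=> ck kM.
apply: le_trans (le_normr_Rintegral _ _) _ => //.
  exact: Re_integrable.
have -> : M * (2 * pi) = \int[mu]_(t in `[0, 2 * pi]) M.
  rewrite Rintegral_cst//= lebesgue_measure_itv/= lte_fin pi2_gt0.
  by rewrite -EFinD /= subr0.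
apply: le_Rintegral => //.
- exact/integrable_norm/Re_integrable.
- apply: continuous_compact_integrable; first exact: segment_compact.
  by apply: continuous_subspaceT => x; exact: cvg_cst.
move=> t; rewrite /= in_itv/= => /kM.
by rewrite -lecR; apply: le_trans; exact: normc_ge_Re.
Qed.

(** The factor 2, which comes from bounding the real and imaginary parts
separately, is harmless: only limits to 0 are deduced. *)
Lemma cint_norm_le k (M : R) : continuous k ->
  (forall t, 0 <= t <= 2 * pi -> `|k t| <= M%:C) ->
  `|cint k| <= (M * (2 * pi) *+ 2)%:C.
Proof.
move=> ck kM; rewrite cintE [X in `|X|]complexE/=.
apply: le_trans (ler_normD _ _) _; rewrite mulr2n rmorphD/=.
rewrite normrM (_ : `|'i%C| = 1 :> C) ?mul1r; last first.
  by rewrite normc_def/= expr0n expr1n add0r sqrtr1.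
have nR (a : R) : `|a%:C| = `|a|%:C :> C.
  by rewrite normc_def/= expr0n addr0 sqrtr_sqr.
have h2 : `|rint (fun t => - 'i%C * k t)| <= M * (2 * pi).
  apply: rint_norm_le; first exact: continuous_mulC.
  move=> t /kM; apply: le_trans; rewrite normrM normrN.
  rewrite (_ : `|'i%C| = 1 :> C) ?mul1r; first exact: lexx.
  by rewrite normc_def/= expr0n expr1n add0r sqrtr1.
by rewrite !nR; apply: lerD; rewrite lecR; [exact: rint_norm_le|exact: h2].
Qed.

(** The fundamental theorem of calculus along a curve. *)
Lemma cint_primitive (P k : R -> C) : continuous k ->
  (forall t, rder P t (k t)) -> cint k = P (2 * pi) - P 0.
Proof.
move=> ck dP.
have main (Q l : R -> C) : continuous l -> (forall t, rder Q t (l t)) ->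
    rint l = complex.Re (Q (2 * pi)) - complex.Re (Q 0).
  move=> cl dQ; rewrite /rint /Rintegral.
  rewrite (@continuous_FTC2 _ _ (fun t => complex.Re (Q t)) _ _ pi2_gt0).
  - by rewrite -EFinB.
  - apply: continuous_subspaceT => x.
    exact: cvg_comp _ _ (cl x) (@Re_continuous _ _).
  - have cQ x : complex.Re (Q t) @[t --> x] --> complex.Re (Q x).
      exact: cvg_comp _ _ (rder_continuous (dQ x)) (@Re_continuous _ _).
    split.
    + by move=> x _; exact: (@ex_derive _ _ _ _ _ _ _ (rder_Re (dQ x))).
    + exact: cvg_at_right_filter.
    + exact: cvg_at_left_filter.
  - move=> x _; rewrite derive1E.
    exact: (@derive_val _ _ _ _ _ _ _ (rder_Re (dQ x))).
have dQ t : rder (fun t => - 'i%C * P t) t (- 'i%C * k t) by exact: rderZ.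
have cQ : continuous (fun t => - 'i%C * k t) by exact: continuous_mulC.
rewrite cintE (main _ _ ck dP) (main _ _ cQ dQ).
by case: (P _) => a b; case: (P _) => c d; simpc.
Qed.

End CircleIntegrals.

(** * Powers on the circle *)

Section CauchyFormula.
Context {R : realType}.
Local Notation C := R[i].
Local Notation mu := (@lebesgue_measure R).

Lemma cder_horner (p : {poly C}) z : cder (horner p) z (p^`()).[z].
Proof.
elim/poly_ind: p => [|p c IH].
  rewrite deriv0 horner0 (_ : horner 0 = fun=> 0); first exact: slope_along_cst.
  by apply/funext => w; rewrite horner0.
have idz : x @[x --> z] --> z by exact: cvg_id.
have h := slope_alongD (slope_alongM idz IH (slope_along_id id z))
  (slope_along_cst id z c).
rewrite (_ : horner _ = fun w => p.[w] * w + c); last first.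
  by apply/funext => w; rewrite hornerMXaddC.
rewrite (_ : (_).[z] = (p^`()).[z] * z + p.[z] * 1 + 0); first exact: h.
by rewrite derivD derivM derivX derivC mulr1 !hornerE.
Qed.

Lemma circle_point_neq0 (r t : R) : 0 < r -> circle_point r t != 0 :> C.
Proof.
by move=> r0; rewrite -normr_eq0 norm_circle_point ?ltW// gt_eqF// ltcR.
Qed.

Lemma continuous_circle_point (r : R) : continuous (circle_point r : R -> C).
Proof. by move=> t; exact: rder_continuous (rder_circle_point r t). Qed.

Lemma continuous_circle_inv (r : R) n : 0 < r ->
  continuous (fun t => (circle_point r t : C)^-1 ^+ n).
Proof.
move=> r0 t.
have c1 : (circle_point r t : C)^-1 @[t --> t] --> (circle_point r t : C)^-1.
  exact: cvg_comp _ _ (@continuous_circle_point r t)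
    (inv_continuous (circle_point_neq0 t r0)).
elim: n => [|n IH]; first exact: cvg_cst.
under eq_fun do rewrite exprS.
exact: cvgM c1 IH.
Qed.

Lemma rder_circle_inv (r t : R) n : 0 < r ->
  rder (fun t => (circle_point r t : C)^-1 ^+ n) t
    (- 'i%C *+ n * (circle_point r t)^-1 ^+ n).
Proof.
move=> r0; have z0 := circle_point_neq0 t r0.
have h1 := rder_comp (rder_circle_point r t) (cderV z0).
have h2 := rder_comp h1 (cder_horner 'X^n _).
rewrite (_ : (fun t => _) = fun t => ('X^n).[(circle_point r t : C)^-1]); last first.
  by apply/funext => s; rewrite hornerXn.
rewrite [X in rder _ _ X](_ : _ = ('X^n)^`().[(circle_point r t)^-1] *
  (- (circle_point r t) ^- 2 * ('i%C * circle_point r t))); first exact: h2.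
rewrite derivXn hornerMn hornerXn.
case: n h2 => [|n] _; first by rewrite !mulr0n !mul0r.
rewrite /= [in LHS]exprS -mulr_natl -[in RHS]mulr_natl; field.
exact: z0.
Qed.

Lemma cint1 : cint (fun=> 1 : C) = (2 * pi)%:C.
Proof.
rewrite (@cint_primitive _ (fun t : R => t%:C)) ?subr0//.
  by move=> t; exact: cvg_cst.
by move=> t; exact: slope_along_id.
Qed.

(** A primitive of z^(-n) along the circle is i z^(-n) / n, which is periodic. *)
Lemma cint_circle_inv (r : R) n : 0 < r -> (0 < n)%N ->
  cint (fun t => (circle_point r t : C)^-1 ^+ n) = 0.
Proof.
move=> r0 n0.
have c0 : - 'i%C *+ n != 0 :> C.
  by rewrite mulrn_eq0 negb_or -lt0n n0 oppr_eq0/= eq_complex/= oner_eq0 andbF.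
pose P t : C := (- 'i%C *+ n)^-1 * (circle_point r t)^-1 ^+ n.
rewrite (@cint_primitive _ P); first by rewrite /P circle_point_2pi subrr.
  exact: continuous_circle_inv.
move=> t; have := rderZ (- 'i%C *+ n)^-1 (rder_circle_inv t n r0).
by rewrite mulKf.
Qed.

Lemma cint_circle (r : R) : cint (circle_point r : R -> C) = 0.
Proof.
pose P t : C := - 'i%C * circle_point r t.
rewrite (@cint_primitive _ P); first by rewrite /P circle_point_2pi subrr.
  exact: continuous_circle_point.
move=> t; have := rderZ (- 'i%C) (rder_circle_point r t).
by rewrite mulrA mulNr -expr2 sqr_i opprK mul1r.
Qed.

Lemma bounded_on_circle (k : R -> C) : continuous k ->
  exists M : R, forall t, 0 <= t <= 2 * pi -> `|k t| <= M%:C.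
Proof.
move=> ck.
have cn : continuous (fun t => complex.Re `|k t|).
  by move=> t; exact: cvg_comp _ _ (cvg_norm (ck t)) (@Re_continuous _ _).
have [c _ hc] := EVT_max (ltW pi2_gt0) (continuous_subspaceT cn).
exists (complex.Re `|k c|) => t t2.
by rewrite -real_norm lecR; apply: hc; rewrite in_itv.
Qed.

Lemma rint_cint (k : R -> C) : rint k = complex.Re (cint k).
Proof. by rewrite cintE. Qed.

Lemma norm_real (a : R) : `|a%:C| = `|a|%:C :> C.
Proof. by rewrite normc_def/= expr0n addr0 sqrtr_sqr. Qed.

End CauchyFormula.

(** * The Cauchy formula and Taylor expansion on a disk *)

Section Taylor.
Context {R : realType}.
Local Notation C := R[i].
Local Notation mu := (@lebesgue_measure R).

Lemma Rintegrable_cst (M : R) : mu.-integrable `[0, 2 * pi] (EFin \o (fun=> M)).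
Proof.
apply: continuous_compact_integrable; first exact: segment_compact.
by apply: continuous_subspaceT => x; exact: cvg_cst.
Qed.

Section Homotopy.
Variables (r0 r : R) (h h' : C -> C) (w : C).
Hypothesis hC1 : C1_disk r0%:C h h'.
Hypothesis (r_gt0 : 0 < r) (r_r0 : r < r0) (wr : `|w| < r%:C).

Let z (t : R) : C := circle_point r t.
Let P (l t : R) : C := w + l%:C * (z t - w).
(** A margin on both sides of [0, 1], so that the integral is differentiable at
the end points too. *)
Let e : R := (r0 - r) / (4 * r).

Let e_gt0 : 0 < e.
Proof. by rewrite divr_gt0 ?subr_gt0// mulr_gt0. Qed.

Let cont_z : continuous z. Proof. exact: continuous_circle_point. Qed.

Let P_disk l t : - e <= l <= 1 + e -> `|P l t| < r0%:C.
Proof.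
move=> /andP[le1 le2].
have -> : P l t = (1 - l)%:C * w + l%:C * z t.
  by rewrite /P rmorphB rmorph1; ring.
have zr : `|z t| = r%:C by rewrite norm_circle_point// ltW.
(* P l t = (1 - l) w + l z, and |1 - l| + |l| <= 1 + 2 e on this interval. *)
have -> : r0%:C = ((1 + 4 * e) * r)%:C.
  congr (_%:C); rewrite /e; field; exact: lt0r_neq0.
apply: le_lt_trans (ler_normD _ _) _; rewrite !normrM !norm_real zr.
apply: (@le_lt_trans _ _ (`|1 - l|%:C * r%:C + `|l|%:C * r%:C)).
  by rewrite lerD2r; apply: ler_wpM2l; [rewrite lecR|exact: ltW].
rewrite -!rmorphM -rmorphD ltcR -mulrDl ltr_pM2r//.
have ? : 0 < e by exact: e_gt0.
by case: (ger0P l) => ?; case: (ger0P (1 - l)) => ?; lra.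
Qed.

Let z_w t : z t - w != 0.
Proof.
rewrite subr_eq0; apply: contraTneq wr => <-.
by rewrite norm_circle_point ?ltxx// ltW.
Qed.

Let rderP_t l t : rder (P l) t (l%:C * ('i%C * z t)).
Proof.
have := slope_alongD (rder_cst w t)
  (rderZ l%:C (slope_alongD (rder_circle_point r t) (rder_cst (- w) t))).
by rewrite add0r addr0; apply.
Qed.

Let rderP_l l t : rder (P^~ t) l (z t - w).
Proof.
have id1 : rder (fun y : R => y%:C : C) l 1 by exact: slope_along_id.
have := slope_alongD (rder_cst w l) (rderM id1 (rder_cst (z t - w) l)).
by rewrite add0r mulr0 addr0 mul1r; apply.
Qed.

Let cont_hP l : - e <= l <= 1 + e -> continuous (fun t => h (P l t)).
Proof.
move=> le t; have [hd _] := hC1 (P_disk t le).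
exact: rder_continuous (rder_comp (rderP_t l t) hd).
Qed.

Let cont_h'P l : - e <= l <= 1 + e -> continuous (fun t => h' (P l t)).
Proof.
move=> le t; have [_ hc] := hC1 (P_disk t le).
exact: cvg_comp _ _ (rder_continuous (rderP_t l t)) hc.
Qed.

(** A primitive of h'(P l t) z(t) is h(P l t) / (i l), which is periodic; this
fails at l = 0, where P is constant and the integral of z itself vanishes. *)
Let cint_h'P l : - e <= l <= 1 + e -> cint (fun t => h' (P l t) * z t) = 0.
Proof.
move=> le.
have [->|l0] := eqVneq l 0.
  rewrite (_ : (fun t => _) = fun t => h' w * z t); last first.
    by apply/funext => t; rewrite /P rmorph0 mul0r addr0.
  by rewrite cintZ ?cint_circle ?mulr0//; exact: cont_z.
have ck : continuous (fun t => h' (P l t) * z t).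
  by move=> t; exact: (cvgM (@cont_h'P _ le t) (@cont_z t)).
have c0 : l%:C * 'i%C != 0 :> C.
  apply: mulf_neq0; first by rewrite eq_complex/= eqxx andbT.
  by rewrite eq_complex/= oner_eq0 andbF.
apply: (mulfI c0); rewrite mulr0 -cintZ//.
rewrite (@cint_primitive _ (fun t => h (P l t))).
- by rewrite /P /z circle_point_2pi subrr.
- exact: continuous_mulC.
move=> t; have [hd _] := hC1 (P_disk t le).
have := rder_comp (rderP_t l t) hd.
by congr rder; ring.
Qed.

(** Compactness of a rectangle of parameters: this provides the domination under
which the integral is differentiated. *)
Let h'P_bounded : exists M : R, forall l t, - e <= l <= 1 + e ->
  0 <= t <= 2 * pi -> `|h' (P l t)| <= M%:C.
Proof.
have cA : compact (`[- e, 1 + e] `*` `[0, 2 * pi] : set (R * R)).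
  by apply: compact_setX; exact: segment_compact.
have cf : {within `[- e, 1 + e] `*` `[0, 2 * pi],
    continuous (fun x : R * R => complex.Re `|h' (P x.1 x.2)|)}.
  apply: continuous_in_subspaceT => -[l t]; rewrite inE/= !in_itv/= => -[le _].
  have [_ hc] := hC1 (P_disk t le).
  have f1 : x.1 @[x --> (l, t)] --> l by exact: cvg_fst.
  have f2 : x.2 @[x --> (l, t)] --> t by exact: cvg_snd.
  have c1 : (x.1)%:C @[x --> (l, t)] --> (l%:C : C).
    exact: (cvg_comp _ _ f1 (@real_complex_continuous _ l)).
  have c2 : z x.2 - w @[x --> (l, t)] --> z t - w.
    exact: (cvgB (cvg_comp _ _ f2 (@cont_z t)) (cvg_cst _)).
  have c3 : P x.1 x.2 @[x --> (l, t)] --> P l t.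
    exact: (cvgD (cvg_cst _) (cvgM c1 c2)).
  exact: (cvg_comp _ _ (cvg_norm (cvg_comp _ _ c3 hc)) (@Re_continuous _ _)).
have A0 : (`[- e, 1 + e] `*` `[0, 2 * pi] : set (R * R)) !=set0.
  exists (0, 0); rewrite /= !in_itv/= lexx oppr_le0 (ltW e_gt0).
  by rewrite addr_ge0 ?(ltW e_gt0)//= (ltW pi2_gt0).
have [c _ hc] := compact_EVT_max A0 cA cf.
exists (complex.Re `|h' (P c.1 c.2)|) => l t le t2.
by rewrite -real_norm lecR; apply: (hc (l, t)); rewrite inE/= !in_itv.
Qed.

Let kern (c : C) t : C := c * (z t / (z t - w)).

Let cont_kern c : continuous (kern c).
Proof.
move=> t.
have cz := @cont_z t.
have czw : z x - w @[x --> t] --> z t - w by exact: cvgB cz (cvg_cst _).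
have ci := cvg_comp _ _ czw (inv_continuous (z_w t)).
exact: cvgM (cvg_cst _) (cvgM cz ci).
Qed.

Let F c l t : R := complex.Re (kern c t * h (P l t)).

Let derF c l t : - e <= l <= 1 + e ->
  is_derive l (1 : R) (F c ^~ t) (complex.Re (c * (h' (P l t) * z t))).
Proof.
move=> le; have [hd _] := hC1 (P_disk t le).
have := rder_Re (rderZ (kern c t) (rder_comp (rderP_l l t) hd)).
rewrite (_ : kern c t * _ = c * (h' (P l t) * z t))//.
by rewrite /kern; field; exact: z_w.
Qed.

Let derivative_zero c l : l \in `]- e, 1 + e[ ->
  is_derive l (1 : R) (fun l => rint (fun t => kern c t * h (P l t))) 0.
Proof.
move=> le.
have itvW x : x \in `]- e, 1 + e[ -> - e <= x <= 1 + e.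
  by rewrite in_itv/= => /andP[/ltW -> /ltW ->].
have [M hM] := h'P_bounded.
have M0 : 0 <= M.
  have := hM l 0 (itvW _ le); rewrite lexx (ltW pi2_gt0) => /(_ isT).
  by move/(le_trans (normr_ge0 _)); rewrite ler0c.
pose G (_ : R) := complex.Re `|c| * (M * r).
have rec0 : 0 <= complex.Re `|c| by rewrite -ler0c real_norm.
have intF x : x \in `]- e, 1 + e[ -> mu.-integrable `[0, 2 * pi] (EFin \o F c x).
  move=> /itvW xe; apply: Re_integrable => t.
  exact: (cvgM (@cont_kern c t) (@cont_hP _ xe t)).
have derF' x y : x \in `]- e, 1 + e[ -> y \in `[0, 2 * pi] ->
    derivable (F c ^~ y) x 1.
  by move=> /itvW xe _; exact: (@ex_derive _ _ _ _ _ _ _ (derF c y xe)).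
have d1F x y : x \in `]- e, 1 + e[ ->
    partial1of2 (F c) x y = complex.Re (c * (h' (P x y) * z y)).
  move=> /itvW xe; rewrite partial1of2E.
  exact: (@derive_val _ _ _ _ _ _ _ (derF c y xe)).
have G_ge0 y : 0 <= G y by rewrite !mulr_ge0// ltW.
have intG : mu.-integrable `[0, 2 * pi] (EFin \o G) by exact: Rintegrable_cst.
have G_ub x y : x \in `]- e, 1 + e[ -> y \in `[0, 2 * pi] ->
    `|partial1of2 (F c) x y| <= G y.
  move=> xe ye; rewrite d1F// -lecR.
  have -> : (G y)%:C = `|c| * (M%:C * r%:C) by rewrite /G !rmorphM/= real_norm.
  apply: le_trans (normc_ge_Re _) _; rewrite normrM; apply: ler_wpM2l.
    exact: normr_ge0.
  rewrite normrM norm_circle_point; last exact: ltW.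
  apply: ler_wpM2r; first by rewrite ler0c ltW.
  by apply: hM; [exact: itvW|move: ye; rewrite in_itv].
have mI : measurable (`[0, 2 * pi] : set (measurableTypeR R)) by [].
have D := derivable_under_integral mI le intF derF' G_ge0 intG G_ub.
have V := differentiation_under_integral mI le intF derF' G_ge0 intG G_ub.
apply: DeriveDef; first exact: D.
rewrite -derive1E V.
transitivity (rint (fun t => c * (h' (P l t) * z t))).
  by apply: eq_Rintegral => t _; exact: d1F.
rewrite rint_cint cintZ.
  by rewrite cint_h'P ?mulr0//; exact: itvW.
move=> t; exact: (cvgM (@cont_h'P _ (itvW _ le) t) (@cont_z t)).
Qed.

(** Contracting the circle to [w] does not change the Cauchy integral. *)
Lemma cint_homotopy :
  cint (fun t => h (z t) * (z t / (z t - w))) =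
  h w * cint (fun t => z t / (z t - w)).
Proof.
(* A complex constant c in the kernel makes the real part of the integral
   enough: c = 1 and c = - i give both parts. *)
have main c : rint (fun t => kern c t * h (P 1 t)) =
    rint (fun t => kern c t * h (P 0 t)).
  pose J l := rint (fun t => kern c t * h (P l t)).
  have sub (x : R) : x \in `[0, 1] -> x \in `]- e, 1 + e[.
    rewrite !in_itv/= => /andP[x0 x1]; apply/andP; split.
      by rewrite (lt_le_trans _ x0)// oppr_lt0.
    by rewrite (le_lt_trans x1)// ltrDl.
  have cJ : {within `[0, 1], continuous J}.
    apply: derivable_within_continuous => x /sub xe.
    exact: (@ex_derive _ _ _ _ _ _ _ (derivative_zero c xe)).
  have dJ (x : R) : x \in `]0, 1[ -> is_derive x (1 : R) J 0.
    by move=> x01; apply: derivative_zero; apply: sub; exact: subset_itv_oo_cc.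
  have [_ _] := MVT ltr01 dJ cJ.
  by rewrite mul0r => /eqP; rewrite subr_eq0 => /eqP.
have P1 t : P 1 t = z t by rewrite /P rmorph1 mul1r addrC subrK.
have P0 t : P 0 t = w by rewrite /P rmorph0 mul0r addr0.
have main' c : rint (fun t => c * (h (z t) * (z t / (z t - w)))) =
    rint (fun t => c * (h w * (z t / (z t - w)))).
  have := main c.
  rewrite (_ : (fun t => _) = fun t => c * (h (z t) * (z t / (z t - w)))); last first.
    by apply/funext => t; rewrite P1 /kern -!mulrA [h _ * _]mulrC !mulrA.
  move=> ->; congr rint.
  by apply/funext => t; rewrite P0 /kern -!mulrA [h _ * _]mulrC !mulrA.
have E1 (k : R -> C) : k = fun t => 1 * k t.
  by apply/funext => t; rewrite mul1r.
transitivity (cint (fun t => h w * (z t / (z t - w)))).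
  by rewrite !cintE main' (E1 (fun t => h (z t) * _)) main' -E1.
apply: cintZ; rewrite (_ : (fun t => _) = kern 1); first exact: cont_kern.
by apply/funext => t; rewrite /kern mul1r.
Qed.

End Homotopy.

(** The partial sums of the geometric series leave the remainder (w/z)^N times
the kernel, whose integral tends to 0 like (|w|/r)^N. *)
Lemma cint_geometric (r : R) (w : C) (k : R -> C) : 0 < r -> `|w| < r%:C ->
  continuous k ->
  series (fun n => cint (fun t => k t * (circle_point r t)^-1 ^+ n) * w ^+ n)
    @ \oo --> cint (fun t => k t * (circle_point r t / (circle_point r t - w))).
Proof.
move=> r0 wr ck.
set z := circle_point r.
have z0 t : z t != 0 by exact: circle_point_neq0.
have zw t : z t - w != 0.
  rewrite subr_eq0; apply: contraTneq wr => <-.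
  by rewrite norm_circle_point ?ltxx// ltW.
have cz : continuous z by exact: continuous_circle_point.
have cK : continuous (fun t => k t * (z t / (z t - w))).
  move=> t; have czw : z x - w @[x --> t] --> z t - w.
    exact: (cvgB (@cz t) (cvg_cst _)).
  have ci := cvg_comp _ _ czw (inv_continuous (zw t)).
  exact: (cvgM (@ck t) (cvgM (@cz t) ci)).
have cinv n : continuous (fun t => (z t)^-1 ^+ n) by exact: continuous_circle_inv.
pose rest n t := (k t * (z t / (z t - w))) * (z t)^-1 ^+ n.
have crest n : continuous (rest n).
  by move=> t; exact: (cvgM (@cK t) (@cinv n t)).
have partial N :
    series (fun n => cint (fun t => k t * (z t)^-1 ^+ n) * w ^+ n) N =
    cint (fun t => k t * (z t / (z t - w))) - w ^+ N * cint (rest N).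
  elim: N => [|N IH].
    rewrite /series/= big_geq// expr0 mul1r /rest.
    by under [X in _ - cint X]eq_fun do rewrite expr0 mulr1; rewrite subrr.
  have ckz : continuous (fun t => k t * (z t)^-1 ^+ N).
    by move=> t; exact: (cvgM (@ck t) (@cinv N t)).
  have -> : series (fun n => cint (fun t => k t * (z t)^-1 ^+ n) * w ^+ n) N.+1 =
    series (fun n => cint (fun t => k t * (z t)^-1 ^+ n) * w ^+ n) N
      + cint (fun t => k t * (z t)^-1 ^+ N) * w ^+ N.
    by rewrite /series/= big_nat_recr.
  rewrite IH (_ : rest N = fun t =>
    k t * (z t)^-1 ^+ N + w * rest N.+1 t); last first.
    apply/funext => t; rewrite /rest exprS; field.
    by rewrite z0 zw.
  have cw : continuous (fun t => w * rest N.+1 t).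
    exact: (@continuous_mulC _ w (rest N.+1) (crest N.+1)).
  rewrite (cintD ckz cw) (cintZ w (crest N.+1)) exprSr.
  set I1 := cint _; set I2 := cint _; set I3 := cint _; ring.
have [M hM] := bounded_on_circle cK.
have rest_le N : `|w ^+ N * cint (rest N)|
    <= ((M * (2 * pi) *+ 2) * (complex.Re `|w| / r) ^+ N)%:C.
  have h1 : `|cint (rest N)| <= ((M * r^-1 ^+ N) * (2 * pi) *+ 2)%:C.
    apply: cint_norm_le; first exact: crest.
    move=> t /hM kM; rewrite /rest normrM rmorphM/= normrX normfV.
    rewrite norm_circle_point; last exact: ltW.
    by rewrite rmorphXn/= fmorphV ler_wpM2r// exprn_ge0// invr_ge0 ler0c ltW.
  rewrite normrM normrX.
  apply: le_trans (ler_wpM2l _ h1) _; first by rewrite exprn_ge0.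
  rewrite -real_norm -rmorphXn -rmorphM/= lecR.
  by rewrite le_eqVlt; apply/orP; left; apply/eqP; rewrite exprMn; ring.
set L := cint _.
apply/cvgrPdist_lt => eps eps0.
have [q0 q1] : 0 <= complex.Re `|w| / r /\ complex.Re `|w| / r < 1.
  split; first by rewrite divr_ge0 ?(ltW r0)// -ler0c real_norm.
  by rewrite ltr_pdivrMr// mul1r -ltcR real_norm.
have eps0' : 0 < complex.Re eps by move: eps0; rewrite ltcE => /andP[].
have := @cvg_geometric R (M * (2 * pi) *+ 2) (complex.Re `|w| / r).
rewrite ger0_norm// => /(_ q1) /cvgrPdist_lt /(_ _ eps0').
apply: filterS => N; rewrite sub0r normrN /geometric/= => hN.
rewrite partial opprB addrC subrK.
apply: le_lt_trans (rest_le N) _.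
have -> : eps = (complex.Re eps)%:C by rewrite RRe_real// gtr0_real.
by rewrite ltcR; exact: le_lt_trans (ler_norm _) hN.
Qed.

(** Cauchy's formula with its kernel expanded.  The same expansion applied to the
constant 1 evaluates the integral of the kernel. *)
Theorem C1_taylor (r0 r : R) (h h' : C -> C) : C1_disk r0%:C h h' ->
  0 < r -> r < r0 ->
  has_pseries (fun n => (2 * pi)%:C^-1 *
    cint (fun t => h (circle_point r t) * (circle_point r t)^-1 ^+ n)) 0 r%:C h.
Proof.
move=> hC1 r_gt0 rr0 w; rewrite subr0 => wr.
have pi2 : (2 * pi)%:C != 0 :> C by rewrite gt_eqF// ltcR pi2_gt0.
have ch : continuous (fun t => h (circle_point r t)).
  move=> t; have zr : `|circle_point r t| < r0%:C.
    by rewrite norm_circle_point ?ltcR// ltW.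
  have [hd _] := hC1 _ zr.
  exact: rder_continuous (rder_comp (rder_circle_point r t) hd).
have hB := cint_geometric r_gt0 wr ch.
have c1 : continuous (fun _ : R => 1 : C) by move=> t; exact: cvg_cst.
have hA := cint_geometric r_gt0 wr c1.
have kern_int : cint (fun t => circle_point r t / (circle_point r t - w)) =
    (2 * pi)%:C.
  rewrite (_ : (fun t => circle_point r t / _) =
    fun t => 1 * (circle_point r t / (circle_point r t - w))); last first.
    by apply/funext => t; rewrite mul1r.
  (* All the terms of this series vanish but the first one. *)
  suff hA' : series (fun n =>
      cint (fun t => 1 * (circle_point r t : C)^-1 ^+ n) * w ^+ n)
      @ \oo --> (2 * pi)%:C.
    exact: (cvg_unique _ hA hA').
  rewrite -(cvg_shiftn 1)/=; apply: cvg_near_cst; apply: nearW => n.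
  rewrite /series/= addn1 big_mkord big_ord_recl big1 ?addr0.
    rewrite expr0 mulr1 -cint1; congr cint.
    by apply/funext => t; rewrite expr0 mulr1.
  move=> i _; rewrite (_ : (fun t => _) =
    fun t => (circle_point r t : C)^-1 ^+ (bump 0 i)); last first.
    by apply/funext => t; rewrite mul1r.
  by rewrite cint_circle_inv ?mul0r.
rewrite (cint_homotopy hC1 r_gt0 rr0 wr) kern_int in hB.
have -> : h w = (2 * pi)%:C^-1 * (h w * (2 * pi)%:C) by rewrite mulrCA mulVf// mulr1.
set u := (fun n => _ * w ^+ n) in hB.
rewrite (_ : series _ = fun N => (2 * pi)%:C^-1 * series u N).
  exact: (cvgM (cvg_cst _) hB).
apply/funext => N; rewrite /series/= mulr_sumr; apply: eq_bigr => n _.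
by rewrite mulrA.
Qed.

(** The coefficients do not depend on the radius since they are those of the
successive derivatives at 0; this lets the radius grow to that of the disk. *)
Theorem C1_pseries (r0 : R) (h h' : C -> C) : 0 < r0 -> C1_disk r0%:C h h' ->
  exists2 a, has_pseries a 0 r0%:C h &
    forall r n, 0 < r -> r < r0 -> a n = (2 * pi)%:C^-1 *
      cint (fun t => h (circle_point r t) * (circle_point r t)^-1 ^+ n).
Proof.
move=> r0_gt0 hC1.
have fact0 n : n`!%:R != 0 :> C by rewrite pnatr_eq0 -lt0n fact_gt0.
pose a n := n`!%:R^-1 * derive1n n h 0.
have aE r n : 0 < r -> r < r0 -> a n = (2 * pi)%:C^-1 *
      cint (fun t => h (circle_point r t) * (circle_point r t)^-1 ^+ n).
  move=> r_gt0 rr0; have r_gt0' : 0 < r%:C by rewrite ltcR.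
  by rewrite /a (derive1n_pseries n r_gt0' (C1_taylor hC1 r_gt0 rr0)) mulKf.
exists a; last exact: aE.
move=> w; rewrite subr0 -real_norm ltcR => /midf_lt[wr rr0].
set r := _ / 2 in wr rr0.
have r_gt0 : 0 < r by apply: le_lt_trans wr; rewrite -ler0c real_norm.
have wr' : `|w - 0| < r%:C by rewrite subr0 -real_norm ltcR.
rewrite (_ : (fun n => a n * w ^+ n) = fun n => (2 * pi)%:C^-1 *
    cint (fun t => h (circle_point r t) * (circle_point r t)^-1 ^+ n) * w ^+ n).
  by have := C1_taylor hC1 r_gt0 rr0 wr'; rewrite subr0; apply.
by apply/funext => n; rewrite (aE r).
Qed.
End Taylor.

(** * Operations on C1 functions, and Taylor polynomials at 0 *)

Section C1Closure.
Context {R : realType}.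
Local Notation C := R[i].

Lemma C1_diskW (r s : C) (h h' : C -> C) : s <= r -> C1_disk r h h' -> C1_disk s h h'.
Proof. by move=> sr hC1 z zs; apply: hC1; exact: lt_le_trans sr. Qed.

Lemma C1_disk_cst (r c : C) : C1_disk r (fun=> c) (fun=> 0).
Proof.
move=> z _; split; first exact: slope_along_cst.
exact: (@cvg_cst C 0 C (nbhs z) (nbhs_filter z)).
Qed.

Lemma C1_diskM (r : C) (h h' k k' : C -> C) : C1_disk r h h' -> C1_disk r k k' ->
  C1_disk r (fun w => h w * k w) (fun w => h' w * k w + h w * k' w).
Proof.
move=> hC1 kC1 z zr; have [hd hc] := hC1 z zr; have [kd kc] := kC1 z zr.
have idz : x @[x --> z] --> z by exact: cvg_id.
split; first exact: (slope_alongM idz hd kd).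
exact: (cvgD (cvgM hc (cder_continuous kd)) (cvgM (cder_continuous hd) kc)).
Qed.

Lemma C1_disk_comp (r : C) (h h' k k' : C -> C) : C1_disk r h h' ->
  (forall z, `|z| < r -> cder k (h z) (k' (h z)) /\ k' x @[x --> h z] --> k' (h z)) ->
  C1_disk r (fun w => k (h w)) (fun w => k' (h w) * h' w).
Proof.
move=> hC1 kC1 z zr; have [hd hc] := hC1 z zr; have [kd kc] := kC1 z zr.
have idz : x @[x --> z] --> z by exact: cvg_id.
split; first exact: (slope_along_comp idz hd kd).
exact: (cvgM (cvg_comp _ _ (cder_continuous hd) kc) hc).
Qed.

Lemma C1_disk_horner (r : C) (h h' : C -> C) (p : {poly C}) : C1_disk r h h' ->
  C1_disk r (fun w => p.[h w]) (fun w => (p^`()).[h w] * h' w).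
Proof.
move=> hC1; apply: (C1_disk_comp (k' := horner p^`()) hC1) => z _.
split; first exact: cder_horner.
exact: (cder_continuous (cder_horner p^`() (h z))).
Qed.

Lemma C1_diskV (r : C) (h h' : C -> C) : C1_disk r h h' ->
  (forall z, `|z| < r -> h z != 0) ->
  C1_disk r (fun w => (h w)^-1) (fun w => - (h w) ^- 2 * h' w).
Proof.
move=> hC1 h0; apply: (C1_disk_comp (k' := fun w => - w ^- 2) hC1) => z zr.
split; first exact: cderV (h0 z zr).
have hz := h0 z zr; have h2 : h z ^+ 2 != 0 by rewrite expf_neq0.
have sq : w ^+ 2 @[w --> h z] --> h z ^+ 2.
  have idz : w @[w --> h z] --> h z by exact: cvg_id.
  exact: (cvgM idz idz).
exact: (cvgN (cvg_comp _ _ sq (inv_continuous h2))).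
Qed.

(** The partial sums of norms are bounded by the real exponential of the norm. *)
Lemma cexp_pseries (r : C) : has_pseries (fun n => n`!%:R^-1) 0 r (@cexp R).
Proof.
move=> z _; rewrite subr0.
rewrite (_ : (fun n => _) = fun n => z ^+ n / n`!%:R); last first.
  by apply/funext => n; rewrite mulrC.
suff : exists l : C, series (fun n => z ^+ n / n`!%:R) @ \oo --> l.
  move=> [l hl]; rewrite (_ : cexp z = l)//.
  by apply: cvg_lim; [exact: norm_hausdorff|exact: hl].
apply: (@cvg_norm_summable _ _ (expR (complex.Re `|z|))%:C) => N.
have z0 : 0 <= complex.Re `|z| by rewrite -ler0c real_norm.
rewrite (_ : \sum_(k < N) _ =
    (series (exp_coeff (complex.Re `|z|)) N)%:C); last first.
  rewrite /series/= big_mkord rmorph_sum/=; apply: eq_bigr => k _.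
  rewrite /exp_coeff/= rmorphM rmorphXn/= real_norm normrM normrX normfV.
  by rewrite normr_nat fmorphV rmorph_nat.
rewrite lecR; apply: nondecreasing_cvgn_le; last exact: is_cvg_series_exp_coeff.
apply: nondecreasing_series => n _ _; rewrite /exp_coeff/=.
by rewrite divr_ge0// exprn_ge0.
Qed.

Lemma cexp_C1 (z : C) : cder (@cexp R) z (derive1 (@cexp R) z) /\
  derive1 (@cexp R) x @[x --> z] --> derive1 (@cexp R) z.
Proof.
apply: (has_pseries_C1 (@cexp_pseries (`|z| + 1))).
by rewrite subr0 ltrDl.
Qed.

Lemma cexp0 : cexp (0 : C) = 1.
Proof.
rewrite (has_pseries_center _ (@cexp_pseries 1))//.
by rewrite fact0 invr1.
Qed.

Lemma C1_disk_exp (r t : C) (h h' q q' : C -> C) :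
  C1_disk r h h' -> C1_disk r q q' ->
  exists k', C1_disk r (fun w => q w * cexp (t * h w)) k'.
Proof.
move=> hC1 qC1.
have tC1 := C1_diskM (C1_disk_cst t (r := r)) hC1.
have eC1 := C1_disk_comp (k := @cexp R) (k' := derive1 (@cexp R)) tC1
  (fun z _ => cexp_C1 _).
by eexists; exact: (C1_diskM qC1 eC1).
Qed.

End C1Closure.

Section TaylorPolynomials.
Context {R : realType}.
Local Notation C := R[i].
Implicit Types (h u : C -> C) (P Q U : {poly C}).

(** Neighbourhoods of 0 are handled by explicit radii; the harmonic combination
of two radii replaces their minimum, complex numbers being only partially
ordered. *)
Definition near0 (A : C -> Prop) := exists2 r : C, 0 < r &
  forall w, `|w| < r -> A w.

Lemma near0S (A B : C -> Prop) : near0 A -> (forall w, A w -> B w) -> near0 B.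
Proof. by move=> [r r0 hA] AB; exists r => // w /hA/AB. Qed.

Lemma near0I (A B : C -> Prop) : near0 A -> near0 B -> near0 (fun w => A w /\ B w).
Proof.
move=> [r r0 hA] [s s0 hB].
have rs0 : 0 < r + s by exact: addr_gt0.
exists (r * s / (r + s)); first by rewrite divr_gt0// mulr_gt0.
move=> w wrs; split; [apply: hA|apply: hB]; apply: (lt_le_trans wrs).
  by rewrite ler_pdivrMr// ler_pM2l// lerDr ltW.
by rewrite ler_pdivrMr// mulrC ler_pM2l// lerDl ltW.
Qed.

Lemma near0T (A : C -> Prop) : (forall w, A w) -> near0 A.
Proof. by move=> hA; exists 1. Qed.

Lemma near0_norm_lt (r : C) : 0 < r -> near0 (fun w => `|w| < r).
Proof. by move=> r0; exists r. Qed.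

(** [P] is congruent to [h] modulo O(w^(n+1)).  It need not be truncated:
products of Taylor polynomials can thus be taken as they are. *)
Definition taylor n h P := exists2 K : C, 0 <= K &
  near0 (fun w => `|h w - P.[w]| <= K * `|w| ^+ n.+1).

Lemma horner_bounded P : exists2 K : C, 0 <= K &
  forall w, `|w| <= 1 -> `|P.[w]| <= K.
Proof.
exists (\sum_(i < size P) `|P`_i|); first exact: sumr_ge0.
move=> w w1; rewrite horner_coef; apply: le_trans (ler_norm_sum _ _ _) _.
apply: ler_sum => i _; rewrite normrM normrX ler_piMr//.
by rewrite exprn_ile1.
Qed.

Lemma horner_lipschitz P : exists2 K : C, 0 <= K &
  forall w, `|w| <= 1 -> `|P.[w] - P`_0| <= K * `|w|.
Proof.
elim/poly_ind: P => [|P c _].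
  by exists 0 => // w _; rewrite horner0 coef0 subrr normr0 mul0r.
have [K K0 hK] := horner_bounded P; exists K => // w w1.
rewrite hornerMXaddC coefD coefMX coefC/= add0r addrK normrM.
by rewrite ler_wpM2r// hK.
Qed.

Lemma taylor_cst n (c : C) : taylor n (fun=> c) c%:P.
Proof.
exists 0 => //; apply: near0T => w; rewrite hornerC subrr normr0 mul0r; exact: lexx.
Qed.

Lemma taylorD n h (k : C -> C) P Q : taylor n h P -> taylor n k Q ->
  taylor n (fun w => h w + k w) (P + Q).
Proof.
move=> [K K0 hP] [L L0 kQ]; exists (K + L); first exact: addr_ge0.
apply: (near0S (near0I hP kQ)) => w [{}hP {}kQ]; rewrite hornerD opprD addrACA mulrDl.
by apply: le_trans (ler_normD _ _) _; exact: lerD.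
Qed.

Lemma taylorM n h (k : C -> C) P Q : taylor n h P -> taylor n k Q ->
  taylor n (fun w => h w * k w) (P * Q).
Proof.
move=> [K K0 hP] [L L0 kQ].
have [M M0 PM] := horner_bounded P; have [N N0 QN] := horner_bounded Q.
exists (K * (L + N) + M * L); first by rewrite addr_ge0// mulr_ge0// addr_ge0.
apply: (near0S (near0I (near0I hP kQ) (near0_norm_lt ltr01))).
move=> w [[{}hP {}kQ] /ltW w1].
have -> : h w * k w - (P * Q).[w] =
    (h w - P.[w]) * (k w - Q.[w] + Q.[w]) + P.[w] * (k w - Q.[w]).
  by rewrite hornerM; ring.
apply: le_trans (ler_normD _ _) _; rewrite !normrM mulrDl.
apply: lerD.
  rewrite mulrAC; apply: ler_pM => //.
  apply: le_trans (ler_normD _ _) _; apply: lerD; last exact: QN.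
  by apply: le_trans kQ _; rewrite ler_piMr// exprn_ile1.
by rewrite -mulrA; apply: ler_pM => //; exact: PM.
Qed.

Lemma taylor_comp_poly n u U P : taylor n u U ->
  taylor n (fun w => P.[u w]) (P \Po U).
Proof.
move=> uU; elim/poly_ind: P => [|P c IH].
  rewrite comp_poly0 (_ : (fun w => _) = fun=> 0); first exact: taylor_cst.
  by apply/funext => w; rewrite horner0.
rewrite comp_poly_MXaddC (_ : (fun w => _) = fun w => P.[u w] * u w + c).
  exact: (taylorD (taylorM IH uU) (taylor_cst n c)).
by apply/funext => w; rewrite hornerMXaddC.
Qed.

(** Once the coefficients of lower degree are known to vanish, the difference is
w^k E(w) with |E(w)| = O(|w|), and E(0) = 0 follows by letting w tend to 0. *)
Lemma taylor_uniq n h P Q : taylor n h P -> taylor n h Q ->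
  forall k : nat, (k <= n)%N -> P`_k = Q`_k.
Proof.
move=> [K K0 hP] [L L0 hQ].
pose D := P - Q.
have DKL : near0 (fun w => `|D.[w]| <= (K + L) * `|w| ^+ n.+1).
  apply: (near0S (near0I hP hQ)) => w [{}hP {}hQ].
  rewrite hornerD hornerN -[P.[w]](subrK (h w)) -addrA mulrDl.
  apply: le_trans (ler_normD _ _) _; apply: lerD; last by [].
  by rewrite distrC.
suff D0 (k : nat) : (k <= n)%N -> D`_k = 0.
  by move=> k /D0/eqP; rewrite coefB subr_eq0 => /eqP.
elim/ltn_ind: k => k IH kn.
pose E := drop_poly k D.
have DE : D = E * 'X^k.
  rewrite -[LHS](poly_take_drop k) (_ : take_poly k D = 0) ?add0r//.
  apply/polyP => i; rewrite coef_take_poly coef0.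
  by case: ltnP => // ik; apply: IH => //; exact: leq_trans (ltnW ik) kn.
have Ek : E`_0 = D`_k by rewrite coef_drop_poly.
rewrite -Ek; apply/eqP; apply: contraT => E0.
have [M M0 hM] := horner_lipschitz E.
have KM : 0 < K + L + M + 1 by rewrite ltr_wpDl// !addr_ge0.
have e0 : 0 < `|E`_0| / (K + L + M + 1) by rewrite divr_gt0// normr_gt0.
have := near0I DKL (near0I (near0_norm_lt ltr01) (near0_norm_lt e0)).
move=> [s s0 hs].
have s20 : 0 < s / 2 by rewrite divr_gt0.
have nw : `|s / 2| = s / 2 by rewrite gtr0_norm.
have [] := hs (s / 2).
  by rewrite nw ltr_pdivrMr// ltr_pMr// ltr1n.
rewrite nw; set w := s / 2 in nw s20 * => Dw [w1 we].
have w0 : w != 0 by rewrite gt_eqF.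
have Ew : `|E.[w]| <= (K + L) * w.
  move: Dw; rewrite DE hornerM hornerXn normrM normrX nw.
  rewrite -(subnK (leqW kn)) exprD mulrA ler_pM2r ?exprn_gt0//.
  move=> /le_trans; apply; rewrite ler_wpM2l ?addr_ge0//.
  by rewrite subSn// exprS ler_piMr ?exprn_ile1// ltW.
have := hM w; rewrite nw => /(_ (ltW w1)) Mw.
have : `|E`_0| <= (K + L + M) * w.
  rewrite -(subrK E.[w] E`_0) mulrDl addrC.
  apply: le_trans (ler_normD _ _) _; apply: lerD => //.
  by rewrite distrC.
move: we; rewrite ltr_pdivlMr// => /lt_le_trans /[apply].
by rewrite mulrC ltr_pM2r// gtrDl ltr10.
Qed.

Lemma taylor_pseries n a (r : C) h : 0 < r -> has_pseries a 0 r h ->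
  taylor n h (\poly_(k < n.+1) a k).
Proof.
move=> r0 ah; have [s s0 sr] := midpoint r0; have [s' ss' s'r] := midpoint sr.
have b' := has_pseries_geo_bounded ah (ltW (lt_trans s0 ss')) s'r.
have [K K0 hK] := geo_bounded_sum (ltW s0) ss' b'.
exists (K / s ^+ n.+1); first by rewrite divr_ge0// exprn_ge0// ltW.
apply: (near0S (near0_norm_lt s0)) => w ws.
have wr : `|w - 0| < r by rewrite subr0 (lt_trans ws).
have := ah _ wr; rewrite subr0 -(cvg_shiftn n.+1) => hw.
apply: (cvg_norm_le (cvgB hw (cvg_cst (\poly_(k < n.+1) a k).[w]))) => N.
have E : series (fun k => a k * w ^+ k) (N + n.+1)%N - (\poly_(k < n.+1) a k).[w]
    = \sum_(k < N) a (n.+1 + k)%N * w ^+ (n.+1 + k).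
  rewrite horner_poly addnC /series/= big_mkord big_split_ord/=.
  by rewrite [X in X - _]addrC addrK.
apply: (@le_trans _ _ `|\sum_(k < N) a (n.+1 + k)%N * w ^+ (n.+1 + k)|).
  by rewrite -E; exact: lexx.
apply: le_trans (ler_norm_sum _ _ _) _.
have s1 : 0 < s ^+ n.+1 by rewrite exprn_gt0.
rewrite mulrAC ler_pdivlMr//.
apply: (@le_trans _ _ (\sum_(k < N) `|a (n.+1 + k)%N| * s ^+ (n.+1 + k) * `|w| ^+ n.+1)).
  rewrite mulr_suml; apply: ler_sum => k _.
  rewrite normrM normrX !exprD.
  have -> : `|a (n.+1 + k)%N| * (`|w| ^+ n.+1 * `|w| ^+ k) * s ^+ n.+1 =
    `|a (n.+1 + k)%N| * (`|w| ^+ n.+1 * s ^+ n.+1) * `|w| ^+ k by ring.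
  have -> : `|a (n.+1 + k)%N| * (s ^+ n.+1 * s ^+ k) * `|w| ^+ n.+1 =
    `|a (n.+1 + k)%N| * (`|w| ^+ n.+1 * s ^+ n.+1) * s ^+ k by ring.
  apply: ler_wpM2l; first by rewrite !mulr_ge0// exprn_ge0// ltW.
  by rewrite lerXn2r ?nnegrE ?(ltW s0)// ltW.
rewrite -mulr_suml ler_wpM2r ?exprn_ge0//.
apply: le_trans (hK (n.+1 + N)%N); rewrite big_split_ord/= lerDr.
by apply: sumr_ge0 => k _; rewrite mulr_ge0// exprn_ge0// ltW.
Qed.

(** As u(w) = O(w), the exponential series may be truncated at degree n. *)
Lemma taylor_exp n u U (t : C) : U`_0 = 0 -> taylor n u U ->
  taylor n (fun w => cexp (t * u w)) ((\poly_(k < n.+1) (t ^+ k / k`!%:R)) \Po U).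
Proof.
move=> U0 uU.
have [K K0 expK] := taylor_pseries n ltr01 (@cexp_pseries R 1).
have [L L0 hL] := uU.
have [M M0 hM] := horner_lipschitz U; rewrite U0 in hM.
have uB : near0 (fun w => `|u w| <= (L + M) * `|w|).
  apply: (near0S (near0I hL (near0_norm_lt ltr01))) => w [{}hL /ltW w1].
  rewrite -[u w](subrK U.[w]) mulrDl; apply: le_trans (ler_normD _ _) _.
  apply: lerD; last by have := hM w w1; rewrite subr0.
  apply: le_trans hL _; rewrite ler_wpM2l// exprS ler_piMr// exprn_ile1//.
set E := \poly_(k < n.+1) (t ^+ k / k`!%:R).
have hE : taylor n (fun w => E.[u w]) (E \Po U) by exact: taylor_comp_poly.
have eE : taylor n (fun w => cexp (t * u w) - E.[u w]) 0.
  set B := `|t| * (L + M).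
  have B0 : 0 <= B by rewrite mulr_ge0// addr_ge0.
  exists (K * B ^+ n.+1); first by rewrite mulr_ge0// exprn_ge0.
  have [r r0 hr] := expK.
  have rB : 0 < r / (B + 1) by rewrite divr_gt0// ltr_wpDl.
  apply: (near0S (near0I uB (near0_norm_lt rB))) => w [{}uB wr].
  have tu : `|t * u w| <= B * `|w|.
    by rewrite normrM /B -mulrA ler_wpM2l.
  have tur : `|t * u w| < r.
    apply: le_lt_trans tu _; move: wr; rewrite ltr_pdivlMr ?ltr_wpDl// mulrC.
    by apply: le_lt_trans; rewrite ler_wpM2r// lerDl.
  rewrite horner0 subr0 (_ : E.[u w] =
    (\poly_(k < n.+1) (k`!%:R^-1 : C)).[t * u w]); last first.
    rewrite !horner_poly; apply: eq_bigr => k _.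
    by rewrite exprMn mulrA [_^-1 * _]mulrC.
  apply: le_trans (hr _ tur) _; rewrite -mulrA -exprMn ler_wpM2l// lerXn2r//.
  by rewrite nnegrE mulr_ge0.
have := taylorD eE hE; rewrite add0r.
rewrite (_ : (fun w => _ + _) = fun w => cexp (t * u w)); first by [].
by apply/funext => w; rewrite subrK.
Qed.

End TaylorPolynomials.

(** * Exponential generating functions *)

Section ExponentialCoefficients.
Context {K : numFieldType}.
Implicit Types (P Q U F B : {poly K}).

Lemma poly_fun_inj P Q : (forall t, P.[t] = Q.[t]) -> P = Q.
Proof.
move=> PQ; apply/eqP; rewrite -subr_eq0; apply: contraT => D0.
have rs : all (root (P - Q)) [seq i%:R | i <- iota 0 (size (P - Q))].
  by apply/allP => x _; rewrite /root hornerD hornerN PQ subrr.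
have us : uniq [seq i%:R : K | i <- iota 0 (size (P - Q))].
  rewrite map_inj_uniq ?iota_uniq// => i j /eqP.
  by rewrite eqr_nat => /eqP.
(* There are as many integers in this list as the degree plus one. *)
by have := max_poly_roots D0 rs us; rewrite size_map size_iota ltnn.
Qed.

(** When U(0) = 0, the coefficient of w^n in Q(w) e^(t U(w)), as a polynomial in
t: powers of U beyond n do not contribute to it. *)
Definition exp_coefs n Q U : {poly K} :=
  \poly_(k < n.+1) ((Q * U ^+ k)`_n / k`!%:R).

Lemma coef_exp_comp n Q U (t : K) :
  (Q * ((\poly_(k < n.+1) (t ^+ k / k`!%:R)) \Po U))`_n = (exp_coefs n Q U).[t].
Proof.
rewrite comp_polyE mulr_sumr coef_sum horner_poly.
rewrite (big_ord_widen _ (fun i => (Q * ((\poly_(k < n.+1) (t ^+ k / k`!%:R))`_i *: U ^+ i))`_n)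
  (size_poly _ _)).
rewrite big_mkcond/=; apply: eq_bigr => i _.
case: ltnP => si.
  by rewrite -scalerAr coefZ coef_poly ltn_ord; ring.
have := nth_default 0 si; rewrite coef_poly ltn_ord => /eqP.
rewrite mulf_eq0 invr_eq0 pnatr_eq0 (negPf (lt0n_neq0 (fact_gt0 i))) orbF.
by move/eqP ->; rewrite mulr0.
Qed.

Lemma coef_mul_pow_eq0 n k Q U : U`_0 = 0 -> (n < k)%N -> (Q * U ^+ k)`_n = 0.
Proof.
move=> U0 nk; have [V ->] : exists V, U = V * 'X.
  by exists (drop_poly 1 U); rewrite -[LHS](poly_take_drop 1) expr1
    (_ : take_poly 1 U = 0) ?add0r//; apply/polyP => -[|i];
    rewrite coef_take_poly coef0.
by rewrite exprMn mulrA coefMXn nk.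
Qed.

(** Differentiating Q e^(tU) in t multiplies Q by U.  The truncation at degree n
is harmless as U^k has no coefficient of index n when k > n. *)
Lemma derivn_exp_coefs n l Q U : U`_0 = 0 ->
  (exp_coefs n Q U)^`(l) = exp_coefs n (Q * U ^+ l) U.
Proof.
move=> U0; apply/polyP => i; rewrite coef_derivn !coef_poly -mulrA -exprD.
have f0 k : k`!%:R != 0 :> K by rewrite pnatr_eq0 -lt0n fact_gt0.
case: ifPn => [lin|]; last first.
  rewrite -leqNgt => nli; rewrite mul0rn coef_mul_pow_eq0// mul0r.
  by case: ifP.
rewrite ifT; last exact: leq_ltn_trans (leq_addl _ _) lin.
rewrite -mulr_natr -[(l + i)`!](ffact_fact (leq_addr i l)) addKn natrM.
have a0 : ((l + i) ^_ l)%:R != 0 :> K by rewrite pnatr_eq0 -lt0n ffact_gt0 leq_addr.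
by field; rewrite a0 f0.
Qed.

Lemma exp_coefs_sum n m (c : nat -> K) (Q : nat -> {poly K}) U :
  \sum_(l < m) c l *: exp_coefs n (Q l) U =
  exp_coefs n (\sum_(l < m) c l *: Q l) U.
Proof.
apply/polyP => i; rewrite coef_sum coef_poly.
case: ltnP => ni; last first.
  by rewrite big1// => l _; rewrite coefZ coef_poly ltnNge ni mulr0.
rewrite mulr_suml coef_sum mulr_suml; apply: eq_bigr => l _.
by rewrite coefZ coef_poly ni -scalerAl coefZ mulrA.
Qed.

(** Only the coefficients of index at most n of the factors matter. *)
Lemma exp_coefs_inverse n Q B F U :
  (forall k : nat, (k <= n)%N -> (B * Q)`_k = (k == 0%N)%:R) ->
  exp_coefs n (B * F * Q) U = exp_coefs n F U.
Proof.
move=> BQ; apply/polyP => i; rewrite !coef_poly; case: ifP => // _.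
congr (_ / _); have -> : B * F * Q * U ^+ i = B * Q * (F * U ^+ i) by ring.
rewrite coefM big_ord_recl BQ// mul1r subn0 big1 ?addr0// => j _.
by rewrite BQ ?mul0r// lift0.
Qed.

End ExponentialCoefficients.

Section Main.
Context {R : realType}.
Local Notation C := R[i].

(** The matrix is a column times a row, so the integrand splits into a product. *)
Lemma sobolev_integrand_rank_one d (c : nat -> C) (q1 q2 : {poly C}) t :
  sobolev_integrand (sobolev_matrix d c) q1 q2 t =
  (\sum_(k < d.+1) c k *: q1^`(k)).[t] * ((\sum_(k < d.+1) c k *: q2^`(k)).[t])^*.
Proof.
rewrite /sobolev_integrand /sobolev_matrix mulmxA -(mulmxA (jet d q1 t *m _)).
rewrite mxE big_ord1; congr (_ * _).
  rewrite mxE horner_sum; apply: eq_bigr => k _.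
  by rewrite !mxE hornerZ mulrC.
rewrite mxE horner_sum rmorph_sum; apply: eq_bigr => k _.
by rewrite !mxE hornerZ rmorphM.
Qed.

(** On t = 0 only the terms free of t remain in the double series, and its square
partial sums become ordinary partial sums. *)
Lemma analytic2_slice (H : C -> C -> C) (w0 : C) :
  analytic2_at H 0 w0 -> analytic_at (H 0) w0.
Proof.
move=> [a [r r0 Ha]]; exists (a 0%N); exists r => // w wr.
have t0 : `|0 - 0 : C| < r%:C by rewrite subrr normr0 ltcR.
have [_ hs] := Ha 0 w t0 wr.
move: hs; rewrite -(cvg_shiftn 1) => hs.
rewrite -(cvg_shiftn 1).
have E : (fun N : nat => \sum_(j < N + 1) \sum_(k < N + 1)
    a j k * (0 - 0) ^+ j * (w - w0) ^+ k) =
    (fun N : nat => series (fun n => a 0%N n * (w - w0) ^+ n) (N + 1)%N).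
  apply/funext => N; rewrite /series/= big_mkord addn1 [LHS]big_ord_recl.
  rewrite -[RHS]addr0; congr (_ + _).
    by apply: eq_bigr => k _; rewrite expr0 mulr1.
  rewrite big1// => j _; rewrite big1// => k _.
  by rewrite subrr expr0n/= mulr0 mul0r.
by move: hs; rewrite /= E.
Qed.

Lemma C1_disk_neq0 (r : R) (h h' : C -> C) : 0 < r -> C1_disk r%:C h h' ->
  h 0 != 0 -> exists2 s : R, 0 < s & s <= r /\ forall w, `|w| < s%:C -> h w != 0.
Proof.
move=> r0 hC1 h0.
have [hd _] : cder h 0 (h' 0) /\ h' x @[x --> (0 : C)] --> h' 0.
  by apply: hC1; rewrite normr0 ltcR.
have := cder_continuous hd.
move/cvgrPdist_lt => /(_ `|h 0|); rewrite normr_gt0 => /(_ h0).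
move=> /nbhs_ballP[e /= e0 he].
have e0' : 0 < complex.Re e by move: e0; rewrite ltcE => /andP[].
exists (Num.min (complex.Re e) r); first by rewrite lt_min e0'.
split; first by rewrite ge_min lexx orbT.
move=> w ws; have /he : ball (0 : C) e w.
  rewrite /ball/= sub0r normrN (lt_le_trans ws)//.
  have -> : e = (complex.Re e)%:C by rewrite RRe_real// gtr0_real.
  by rewrite lecR ge_min lexx.
by apply: contraTneq => ->; rewrite subr0 ltxx.
Qed.

Lemma taylor_near_eq n (h k : C -> C) P : near0 (fun w => h w = k w) ->
  taylor n h P -> taylor n k P.
Proof.
move=> hk [K K0 hP]; exists K => //.
by apply: (near0S (near0I hk hP)) => w [<-].
Qed.

Section GeneratingFunction.
Variables (d : nat) (c : nat -> C) (p : {poly C}) (g : nat -> {poly C}).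
Variables (f u : C -> C) (R0 : R).
Hypotheses (c0_neq0 : c 0%N != 0) (pE : p = \poly_(k < d.+1) c k).
Hypotheses (R0_gt0 : 0 < R0) (fan : analytic_on (disk R0) f).
Hypotheses (uan : analytic_on (disk R0) u) (u0 : u 0 = 0).
Hypothesis genG_series : forall t w : C, `|w| < R0%:C ->
  series (fun n => (g n).[t] * (w ^+ n / (n`!)%:R)) @ \oo --> genG f u t w.

Let E n (t : C) : {poly C} := \poly_(k < n.+1) (t ^+ k / k`!%:R).

Let genG_pseries t :
  has_pseries (fun n => (g n).[t] / n`!%:R) 0 R0%:C (genG f u t).
Proof.
move=> w; rewrite subr0 => wR0; have := @genG_series t w wR0.
rewrite (_ : (fun n => _ * (w ^+ n / _)) =
  fun n => (g n).[t] / n`!%:R * w ^+ n); first exact.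
by apply/funext => n; rewrite mulrAC mulrA.
Qed.

Lemma taylor_polynomials n : exists F U B : {poly C},
  [/\ taylor n f F, taylor n u U, U`_0 = 0,
      taylor n (fun w => (p.[u w])^-1) B &
      (forall j : nat, (j <= n)%N -> recip_coef p u j = j`!%:R * B`_j) /\
      (forall k : nat, (k <= n)%N -> (B * (p \Po U))`_k = (k == 0%N)%:R)].
Proof.
have R0_gt0' : 0 < R0%:C by rewrite ltcR.
have fC1 := analytic_C1 fan; have uC1 := analytic_C1 uan.
have [af hf _] := C1_pseries R0_gt0 fC1.
have [au hu _] := C1_pseries R0_gt0 uC1.
have pu0 : p.[u 0] != 0 by rewrite u0 horner_coef0 pE coef_poly.
have puC1 := C1_disk_horner p uC1.
have [s s0 [sR0 pus]] := C1_disk_neq0 R0_gt0 puC1 pu0.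
have s0' : 0 < s%:C by rewrite ltcR.
have sR0' : s%:C <= R0%:C by rewrite lecR.
have [ab hb _] := C1_pseries s0 (C1_diskV (C1_diskW sR0' puC1) pus).
have tu := taylor_pseries n R0_gt0' hu.
have tb := taylor_pseries n s0' hb.
exists (\poly_(k < n.+1) af k), (\poly_(k < n.+1) au k), (\poly_(k < n.+1) ab k).
split => //.
- exact: (taylor_pseries n R0_gt0' hf).
- by rewrite coef_poly -(has_pseries_center R0_gt0' hu).
split.
  by move=> j jn; rewrite coef_poly ltnS jn /recip_coef (derive1n_pseries j s0' hb).
move=> k kn; rewrite -[RHS]coef1.
apply: (taylor_uniq (taylorM tb (taylor_comp_poly p tu)) _ kn).
(* The product of 1/p(u) and p(u) is 1 only where p(u) does not vanish. *)
apply: (taylor_near_eq _ (taylor_cst n 1)).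
by exists s%:C => // w ws; rewrite mulVf// pus.
Qed.

(** Identification of the coefficients.  All Taylor polynomials are taken to the
same order n.  With F, U, B those of f, u and 1/p(u), one gets
g_n = n! [w^n] F e^(tU) and phi_n = n! [w^n] B F e^(tU), and p(D) turns B F into
B F p(U), which is congruent to F. *)
Lemma phi_taylor n :
  (\sum_(k < d.+1) c k *: (phi p u g n)^`(k) = g n) /\
  forall t (r : C) a, 0 < r -> has_pseries a 0 r (genF p f u t) ->
    (phi p u g n).[t] = n`!%:R * a n.
Proof.
have R0_gt0' : 0 < R0%:C by rewrite ltcR.
have f0 k : k`!%:R != 0 :> C by rewrite pnatr_eq0 -lt0n fact_gt0.
have [F [U [B [tf tu U0 tb [bB BpU]]]]] := taylor_polynomials n.
have tG t : taylor n (genG f u t) (F * (E n t \Po U)).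
  exact: (taylorM tf (taylor_exp t U0 tu)).
have gE t k : (k <= n)%N -> (g k).[t] = k`!%:R * (F * (E n t \Po U))`_k.
  move=> kn; rewrite -(taylor_uniq (taylor_pseries n R0_gt0' (@genG_pseries t)) (tG t) kn).
  by rewrite coef_poly ltnS kn mulrC divfK.
have phiE t : (phi p u g n).[t] = n`!%:R * (B * (F * (E n t \Po U)))`_n.
  rewrite /phi horner_sum coefM mulr_sumr; apply: eq_bigr => j _.
  have jn : (j <= n)%N by rewrite -ltnS.
  rewrite hornerZ bB// gE ?leq_subr// -(bin_fact jn) !natrM; ring.
have gF : g n = n`!%:R *: exp_coefs n F U.
  by apply: poly_fun_inj => t; rewrite hornerZ -coef_exp_comp gE.
have phiF : phi p u g n = n`!%:R *: exp_coefs n (B * F) U.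
  by apply: poly_fun_inj => t; rewrite hornerZ -coef_exp_comp phiE mulrA.
split; last first.
  move=> t r a r0 ha; rewrite phiE; congr (_ * _).
  have tF : taylor n (genF p f u t) (B * (F * (E n t \Po U))).
    exact: (taylorM tb (tG t)).
  rewrite -(taylor_uniq (taylor_pseries n r0 ha) tF (leqnn n)).
  by rewrite coef_poly ltnSn.
have pU : p \Po U = \sum_(k < d.+1) c k *: U ^+ k.
  rewrite pE poly_def raddf_sum/=; apply: eq_bigr => k _.
  by rewrite comp_polyZ comp_Xn_poly.
have BFpU : B * F * (p \Po U) = \sum_(k < d.+1) c k *: (B * F * U ^+ k).
  by rewrite pU mulr_sumr; apply: eq_bigr => k _; rewrite scalerAr.
rewrite gF -(exp_coefs_inverse F U BpU) BFpU.
rewrite -(exp_coefs_sum n d.+1 c (fun k => B * F * U ^+ k)) scaler_sumr.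
apply: eq_bigr => k _.
by rewrite phiF derivnZ derivn_exp_coefs// scalerA mulrC -scalerA.
Qed.

End GeneratingFunction.

Lemma genF_factor p f u (t w : C) :
  genF p f u t w = genF p f u 0 w * cexp (t * u w).
Proof. by rewrite /genF /genG mul0r cexp0 mulr1 mulrA. Qed.

(** The analyticity of F in two variables serves through the slice t = 0; the
dependence on t is then explicit. *)
Lemma genF_C1 p f u (R0 R1 T1 : R) (t : C) : 0 < T1 -> R1 <= R0 ->
  analytic_on (disk R0) u -> analytic2_on (polydisk T1 R1) (genF p f u) ->
  exists h', C1_disk R1%:C (genF p f u t) h'.
Proof.
move=> T1_gt0 R10 uan Fan.
have q_an : analytic_on (disk R1) (genF p f u 0).
  move=> w wR1; apply: analytic2_slice; apply: Fan; split => //.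
  by rewrite /disk/= normr0 ltcR.
have R10' : R1%:C <= R0%:C by rewrite lecR.
have [h' hC1] := C1_disk_exp t (C1_diskW R10' (analytic_C1 uan)) (analytic_C1 q_an).
exists h'; rewrite (_ : genF p f u t = fun w => genF p f u 0 w * cexp (t * u w)).
  exact: hC1.
by apply/funext => w; exact: genF_factor.
Qed.

(** The factor i z of dz = i z dt cancels one power of 1/z. *)
Lemma circle_integral_coef (h : C -> C) (r : R) n :
  0 < r -> continuous (fun s => h (circle_point r s)) ->
  circle_integral r (fun w => h w * w ^- n.+1) =
  'i%C * cint (fun s => h (circle_point r s) * (circle_point r s)^-1 ^+ n).
Proof.
move=> r0 ch; rewrite -cintZ; last first.
  move=> s; exact: (cvgM (@ch s) (@continuous_circle_inv _ r n r0 s)).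
congr (cintegral _ _ _); apply/funext => s.
have z0 := @circle_point_neq0 R r s r0.
by rewrite exprVn exprS; field; rewrite z0 expf_neq0.
Qed.

End Main.

(** * The theorem *)

Theorem theorem3 (R : realType) (d : nat) (hd : (0 < d)%N)
  (c : nat -> R[i]) (hcd : c d != 0) (hc0 : c 0%N != 0)
  (p : {poly R[i]}) (hp : p = \poly_(k < d.+1) c k)
  (g : nat -> {poly R[i]})
  (Gamma : set R[i]) (mu_g : {measure set (borelC R) -> \bar R})
  (hg : (Gamma = real_line R /\ OPRL mu_g g) \/
        (Gamma = unit_circle R /\ OPUC mu_g g))
  (f u : R[i] -> R[i]) (R0 : R) (hR0 : 0 < R0)
  (hf : analytic_on (disk R0) f) (hu : analytic_on (disk R0) u)
  (hu0 : u 0 = 0)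
  (hG : forall t w : R[i], `|w| < R0%:C ->
     series (fun n => (g n).[t] * (w ^+ n / (n`!)%:R)) @ \oo --> genG f u t w)
  (T1 R1 : R) (hT1 : 0 < T1) (hR1 : 0 < R1) (hR10 : R1 < R0)
  (hF : analytic2_on (polydisk T1 R1) (genF p f u)) :
  [/\ sobolev_orthogonal Gamma mu_g (sobolev_matrix d c) (phi p u g),
      forall t w : R[i], `|t| < T1%:C -> `|w| < R1%:C ->
        series (fun n => (phi p u g n).[t] * (w ^+ n / (n`!)%:R)) @ \oo
          --> genF p f u t w
    & forall (R2 : R), 0 < R2 -> R2 < R1 -> forall (n : nat) (t : R[i]),
        (phi p u g n).[t] =
          (n`!)%:R / (2 * pi%:C * 'i%C) *
          circle_integral R2
            (fun w => (p.[u w])^-1 * f w * cexp (t * u w) * w ^- n.+1)].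
Proof.
have R10 : R1 <= R0 by exact: ltW.
have R1_gt0' : 0 < R1%:C by rewrite ltcR.
have phiP n := phi_taylor hc0 hp hR0 hf hu hu0 hG n.
have fact0 n : n`!%:R != 0 :> R[i] by rewrite pnatr_eq0 -lt0n fact_gt0.
split.
- have gmu : orthogonal_polys Gamma mu_g g by case: hg => -[-> ].
  have [_ [A [A0 hA]]] := gmu.
  exists A; split => // n m /=; have /= := hA n m.
  rewrite (_ : (fun t : borelC R => _) = fun t : borelC R =>
    sobolev_integrand (sobolev_matrix d c) (phi p u g n) (phi p u g m) t); first exact.
  apply/funext => t; rewrite sobolev_integrand_rank_one.
  by rewrite (phiP n).1 (phiP m).1.
- move=> t w _ wR1.
  have [h' FC1] := genF_C1 t hT1 R10 hu hF.
  have [a ha _] := C1_pseries hR1 FC1.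
  have := ha w; rewrite subr0 => /(_ wR1).
  rewrite (_ : (fun n => a n * w ^+ n) =
    fun n => (phi p u g n).[t] * (w ^+ n / (n`!)%:R)); first exact.
  apply/funext => n; rewrite ((phiP n).2 t _ a R1_gt0' ha).
  by field; exact: fact0.
move=> R2 R2_gt0 R21 n t.
have [h' FC1] := genF_C1 t hT1 R10 hu hF.
have [a ha aE] := C1_pseries hR1 FC1.
rewrite ((phiP n).2 t _ a R1_gt0' ha) (aE R2)//.
have ch : continuous (fun s => genF p f u t (circle_point R2 s)).
  move=> s; have zr : `|circle_point R2 s| < R1%:C.
    by rewrite norm_circle_point ?ltcR// ltW.
  have [Fd _] := FC1 _ zr.
  exact: rder_continuous (rder_comp (rder_circle_point R2 s) Fd).
have -> : (fun w => (p.[u w])^-1 * f w * cexp (t * u w) * w ^- n.+1) =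
    fun w => genF p f u t w * w ^- n.+1.
  by apply/funext => w; rewrite /genF /genG mulrA.
rewrite (circle_integral_coef n R2_gt0 ch); set I := cint _.
have i0 : 'i%C != 0 :> R[i] by rewrite eq_complex/= oner_eq0 andbF.
have p0 : pi%:C != 0 :> R[i] by rewrite gt_eqF// ltcR pi_gt0.
rewrite rmorphM rmorph_nat/=; move: (pi%:C) p0 => P P0; field.
by rewrite i0 P0.
Qed.
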